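(* There exist absolute constants $C,\alpha\in(0,\infty)$ such that the following holds. Let $n,p$ be positive integers, let $A$ be an invertible (deterministic) $n\times n$ real matrix, and let $X$ be an $n\times p$ random matrix following the Bernoulli-Subgaussian model with parameter $\theta$, where $$\frac{2}{n}\le\theta\le\frac{\alpha}{\sqrt n}.$$ Set $Y=AX$. If $p\ge Cn\log n$, then with probability at least $1-1/p$ the modified ER-SpUD algorithm applied to $Y$ successfully recovers all the rows of $X$, i.e. for every $k\in\{1,\dots,n\}$ some nonzero multiple of the $k$-th row $e_k^TX$ of $X$ is present among the vectors $s_{ij}$, $1\le i<j\le p$, returned by the algorithm.
   Context: Bernoulli-Subgaussian model with parameter $\theta\in(0,1)$: the entries of $X$ are $X_{ij}=\chi_{ij}R_{ij}$, where all the variables $\chi_{ij},R_{ij}$ ($1\le i\le n$, $1\le j\le p$) are independent, $\mathbb{P}(\chi_{ij}=1)=1-\mathbb{P}(\chi_{ij}=0)=\theta$, and the $R_{ij}$ are i.i.d. with $\mathbb{E}R_{ij}=0$, $\mu:=\mathbb{E}|R_{ij}|\ge 1/10$ and $\mathbb{P}(|R_{ij}|\ge t)\le 2e^{-t^2/2}$ for all $t>0$. Modified ER-SpUD algorithm: with $e_1,\dots,e_p$ the standard basis of $\mathbb{R}^p$, for every pair $1\le i<j\le p$ let $r_{ij}=Ye_i+Ye_j\in\mathbb{R}^n$, solve the convex problem $\min_{w\in\mathbb{R}^n}\|w^TY\|_1$ subject to $r_{ij}^Tw=1$, and set $s_{ij}=w^TY\in\mathbb{R}^p$ for a minimizer $w$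 (if the problem has no solution, e.g. when $r_{ij}=0$, the pair is skipped). Here $\|x\|_1=\sum_l|x(l)|$ and $e_k$ in $e_k^TX$ denotes the $k$-th standard basis vector of $\mathbb{R}^n$. *)

(* Defs.v *)
From HB Require Import structures.
From mathcomp Require Import all_boot all_order all_algebra.
From mathcomp Require Import all_classical all_reals all_analysis.
Set Implicit Arguments. Unset Strict Implicit. Unset Printing Implicit Defensive.
Import Order.TTheory GRing.Theory Num.Theory.
Local Open Scope classical_set_scope.
Local Open Scope ring_scope.

(* Mutual independence of a finite family of real random variables:
   product rule for every choice of Borel sets (taking B i = setT recovers
   every subfamily). *)
Definition mutually_independent d (T : measurableType d)
  (R : realType) (P : probability T R) (I : finType) (Z : I -> {RV P >-> R}) : Prop :=
  forall B : I -> set R, (forall i, measurable (B i)) ->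
    P (\bigcap_(i in [set: I]) (Z i @^-1` B i)) =
    (\prod_(i : I) P (Z i @^-1` B i))%E.

Definition BS_model d (T : measurableType d) (R : realType) (P : probability T R)
  (n p : nat) (theta : R)
  (chi Rv : 'I_n -> 'I_p -> {RV P >-> R}) : Prop :=
  [/\ 0 < theta < 1,
      mutually_independent
        (fun s : ('I_n * 'I_p) + ('I_n * 'I_p) =>
           match s with inl (i, j) => chi i j | inr (i, j) => Rv i j end),
      (forall i j, P [set w | chi i j w = 1] = theta%:E /\
                   P [set w | chi i j w = 0] = (1 - theta)%:E),
      (forall i j i' j' (B : set R), measurable B ->
          P (Rv i j @^-1` B) = P (Rv i' j' @^-1` B)) &
      (forall i j,
        [/\ ('E_P[Rv i j] = 0)%E,
            ((1 / 10)%:E <= \int[P]_w (`|Rv i j w|)%:E)%E &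
            (forall t : R, 0 < t ->
               (P [set w | (t <= `|Rv i j w|)%R] <= (2 * expR (- (t ^+ 2) / 2))%:E)%E)])].

Definition BS_matrix d (T : measurableType d) (R : realType) (P : probability T R)
  (n p : nat) (chi Rv : 'I_n -> 'I_p -> {RV P >-> R}) (w : T) : 'M[R]_(n, p) :=
  \matrix_(i, j) (chi i j w * Rv i j w).

Definition l1norm (R : realType) (p : nat) (v : 'rV[R]_p) : R := \sum_(l < p) `|v 0 l|.

Definition erspud_feasible (R : realType) (n p : nat) (Y : 'M[R]_(n, p)) (i j : 'I_p)
  (w : 'cV[R]_n) : Prop :=
  ((col i Y + col j Y)^T *m w) 0 0 = 1.

Definition erspud_minimizer (R : realType) (n p : nat) (Y : 'M[R]_(n, p)) (i j : 'I_p)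
  (w : 'cV[R]_n) : Prop :=
  erspud_feasible Y i j w /\
  forall w', erspud_feasible Y i j w' -> l1norm (w^T *m Y) <= l1norm (w'^T *m Y).

(* A valid run of the algorithm: a choice of a minimizer for every pair
   i < j whose problem has a solution (other pairs are skipped). *)
Definition erspud_run (R : realType) (n p : nat) (Y : 'M[R]_(n, p))
  (sel : 'I_p -> 'I_p -> 'cV[R]_n) : Prop :=
  forall i j : 'I_p, (i < j)%N -> (exists w, erspud_minimizer Y i j w) ->
    erspud_minimizer Y i j (sel i j).

(* Success: whatever minimizers are chosen, every row of X appears (up to a
   nonzero scalar) among the returned s_ij = w^T Y, i < j, non-skipped. *)
Definition erspud_recovers (R : realType) (n p : nat) (Y X : 'M[R]_(n, p)) : Prop :=
  forall sel, erspud_run Y sel ->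
  forall k : 'I_n, exists i j : 'I_p,
    [/\ (i < j)%N, (exists w, erspud_minimizer Y i j w) &
        exists c : R, c != 0 /\ (sel i j)^T *m Y = c *: row k X].

(* Main.v *)
(** Put [z = A^T w]: the programs become [min ||z^T X||_1] subject to [b^T z = 1]
with [b = X e_i + X e_j], and row [k] is recovered as soon as [e_k / b_k] is the
unique minimizer. Let [J] be the union of the supports of the two columns. This
holds when (a) [|b_l| <= (2/3) |b_k|] for [l <> k]; (b) for every [v <> 0]
supported off [J], the columns missing [J] contribute more to [||v^T X||_1] than
those hitting [J], so that the minimizer is supported on [J]; (c) for [l] in [J],
most of the mass of row [l] lies in columns hitting [J] only in [l], so that on
[J] the norm [||z^T X||_1] is almost a weighted [l_1]-norm of [z].

(a) If [t] is an upper quantile of [|R|] at level of order [1/(n theta)], a column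
has its [k]-th entry beyond [t], with a prescribed sign, and all others below [t],
with probability of order [1/n]; two such columns meeting only in row [k] are
found with high probability by exposing first one half of the columns and then
the other. (b) The columns [i], [j] are exposed first, which freezes [J]. The
infimum over the [l_1]-sphere is then controlled by symmetrization and the
contraction principle, which reduce the fluctuations to the coordinates of
[sum_a eps_a X e_a], of order [sqrt (p theta log n)], against a mean of order
[p sqrt (theta / n)]. (c) is Chernoff's bound.

All probabilistic estimates are made on a finite product space: the entries
[R_ij] are rounded to finitely many cells, finely enough (depending on [n], [p]
and [theta]) for the strict inequalities in (a)-(c) to pass to the true matrix. *)
Require Import Defs.
From HB Require Import structures.
From mathcomp Require Import all_boot all_order all_algebra.
From mathcomp Require Import all_classical all_reals all_analysis.
From mathcomp Require Import measurable_realfun ring lra.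
Import numFieldNormedType.Exports.
Import Order.TTheory GRing.Theory Num.Theory.
Local Open Scope classical_set_scope.
Local Open Scope ring_scope.
Set Implicit Arguments. Unset Strict Implicit. Unset Printing Implicit Defensive.

(** * Finite probability spaces *)

(** Why two columns are added: in a single column the largest entry may tie with others, as for
    Rademacher [R_ij]. When two columns meet only in row [k], with entries there of the same sign
    and modulus at least [t], entry [k] of their sum is at least [2 t] in modulus while the others
    stay below [t]; this gap is available for every law.

    Why [n log n] columns suffice: the dual norm of [l_1] is a maximum over [n] coordinates and two
    signs, so the whole sphere costs a factor [2 n], where a net would cost a factor exponential in
    [n]. Every failure probability is then at most polynomial in [p] times [exp (- c p / n)]:
    [theta] cancels from [m^2 / theta], with [m] of order [sqrt (theta / n)], and from
    [theta * eta], with [eta] of order [1 / (n theta)].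

    The bound [theta <= alpha / sqrt n] keeps [|J| theta], of order [n theta^2], small: a column
    rarely hits [J]. On a finite sample space, conditioning on frozen columns and suprema over the
    sphere are finite sums and maxima, so no measurability question arises for them. *)

Section FiniteProbability.
Context {R : realType}.

Definition Ex (U : finType) (w f : U -> R) : R := \sum_u w u * f u.

Definition Pr (U : finType) (w : U -> R) (A : pred U) : R :=
  Ex w (fun u => (A u)%:R).

Definition is_dist (U : finType) (w : U -> R) : Prop :=
  (forall u, 0 <= w u) /\ \sum_u w u = 1.

Definition prodw (I U : finType) (w : U -> R) (o : {ffun I -> U}) : R :=
  \prod_i w (o i).

Definition splice (I U : finType) (A : pred I) (o o' : {ffun I -> U}) :
  {ffun I -> U} := [ffun i => if A i then o i else o' i].

Section OneSpace.
Variables (U : finType) (w : U -> R).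
Hypothesis w_dist : is_dist w.

Let w_ge0 u : 0 <= w u. Proof. by case: w_dist. Qed.

Lemma eq_Ex (f g : U -> R) : f =1 g -> Ex w f = Ex w g.
Proof. by move=> fg; apply: eq_bigr => u _; rewrite fg. Qed.

Lemma le_Ex (f g : U -> R) : (forall u, f u <= g u) -> Ex w f <= Ex w g.
Proof. by move=> fg; apply: ler_sum => u _; apply: ler_wpM2l. Qed.

Lemma Ex_ge0 (f : U -> R) : (forall u, 0 <= f u) -> 0 <= Ex w f.
Proof. by move=> f0; apply: sumr_ge0 => u _; apply: mulr_ge0. Qed.

Lemma Ex_cst (c : R) : Ex w (fun=> c) = c.
Proof. by rewrite /Ex -mulr_suml; case: w_dist => _ ->; rewrite mul1r. Qed.

Lemma ExD (f g : U -> R) : Ex w (fun u => f u + g u) = Ex w f + Ex w g.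
Proof. by rewrite /Ex -big_split; apply: eq_bigr => u _; rewrite mulrDr. Qed.

Lemma ExZ (c : R) (f : U -> R) : Ex w (fun u => c * f u) = c * Ex w f.
Proof. by rewrite /Ex mulr_sumr; apply: eq_bigr => u _; rewrite mulrCA. Qed.

Lemma ExZr (c : R) (f : U -> R) : Ex w (fun u => f u * c) = Ex w f * c.
Proof. by rewrite mulrC -ExZ; apply: eq_Ex => u; rewrite mulrC. Qed.

Lemma ExB (f g : U -> R) : Ex w (fun u => f u - g u) = Ex w f - Ex w g.
Proof.
rewrite -mulN1r -ExZ -ExD; apply: eq_Ex => u; by rewrite mulN1r.
Qed.

Lemma Ex_sum (J : finType) (Q : pred J) (f : J -> U -> R) :
  Ex w (fun u => \sum_(j | Q j) f j u) = \sum_(j | Q j) Ex w (f j).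
Proof.
by rewrite /Ex exchange_big; apply: eq_bigr => u _; rewrite mulr_sumr.
Qed.

Lemma Pr_ge0 (A : pred U) : 0 <= Pr w A.
Proof. by apply: Ex_ge0 => u; case: (A u). Qed.

Lemma Pr_le1 (A : pred U) : Pr w A <= 1.
Proof.
by rewrite -[leRHS](Ex_cst 1); apply: le_Ex => u; case: (A u).
Qed.

Lemma le_Pr (A B : pred U) : (forall u, A u -> B u) -> Pr w A <= Pr w B.
Proof.
move=> AB; apply: le_Ex => u; case: (boolP (A u)) => [/AB ->//|_].
by case: (B u).
Qed.

Lemma PrC (A : pred U) : Pr w (fun u => ~~ A u) = 1 - Pr w A.
Proof.
rewrite -[1](Ex_cst 1) -ExB; apply: eq_Ex => u; case: (A u) => /=; ring.
Qed.

Lemma Pr_or (A B : pred U) : Pr w (fun u => A u || B u) <= Pr w A + Pr w B.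
Proof.
rewrite -ExD; apply: le_Ex => u; case: (A u); case: (B u) => //=; lra.
Qed.

Lemma Pr_exists (J : finType) (A : J -> pred U) :
  Pr w (fun u => [exists j, A j u]) <= \sum_j Pr w (A j).
Proof.
rewrite -Ex_sum; apply: le_Ex => u.
case: existsP => [[j Aj]|_]; last by apply: sumr_ge0 => j _; case: (A j u).
by rewrite (bigD1 j) //= Aj lerDl; apply: sumr_ge0 => i _; case: (A i u).
Qed.

Lemma markov_le (f : U -> R) (t : R) (A : pred U) : 0 < t ->
  (forall u, 0 <= f u) -> (forall u, A u -> t <= f u) -> Pr w A <= Ex w f / t.
Proof.
move=> t0 f0 Af; rewrite ler_pdivlMr // mulrC -ExZ; apply: le_Ex => u.
case: (boolP (A u)) => [/Af|]; first by rewrite mulr1.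
by rewrite mulr0.
Qed.

(** Jensen's inequality: the exponential lies above its tangent line at the mean [m]. *)
Lemma expR_Ex (f : U -> R) : expR (Ex w f) <= Ex w (fun u => expR (f u)).
Proof.
set m := Ex w f.
have -> : expR m = Ex w (fun u => expR m * (1 + (f u - m))).
  by rewrite ExZ ExD ExB !Ex_cst subrr addr0 mulr1.
apply: le_Ex => u; rewrite -[in leRHS](subrK m (f u)) [in leRHS]addrC expRD.
by rewrite ler_wpM2l ?expR_ge0 // expR_ge1Dx.
Qed.

End OneSpace.

Section ProductSpace.
Variables (I U : finType) (w : U -> R).
Hypothesis w_dist : is_dist w.

Lemma Ex_prodw (f : I -> U -> R) :
  Ex (prodw w) (fun o : {ffun I -> U} => \prod_i f i (o i)) =
  \prod_i Ex w (f i).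
Proof.
rewrite /Ex bigA_distr_bigA; apply: eq_bigr => o _.
by rewrite /prodw -big_split.
Qed.

Lemma prodw_dist : is_dist (prodw w : {ffun I -> U} -> R).
Proof.
case: w_dist => w0 w1; split; first by move=> o; apply: prodr_ge0.
rewrite -(bigA_distr_bigA (fun _ : I => w)) /= big1 //.
Qed.

(* Exchanging the coordinates in [A] between two independent copies is a
   measure-preserving involution: this is behind both the conditioning on a set
   of coordinates ([Ex_resample]) and the symmetrization. *)
Lemma Ex_swap (A : pred I) (F : {ffun I -> U} -> {ffun I -> U} -> R) :
  Ex (prodw w) (fun o => Ex (prodw w) (F o)) =
  Ex (prodw w) (fun o => Ex (prodw w)
     (fun o' => F (splice A o o') (splice A o' o))).
Proof.
pose G x : R := prodw w x.1 * (prodw w x.2 * F x.1 x.2).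
pose h (x : {ffun I -> U} * {ffun I -> U}) := (splice A x.1 x.2, splice A x.2 x.1).
have hK : involutive h.
  by case=> a b; congr pair; apply/ffunP => i; rewrite !ffunE; case: (A i).
transitivity (\sum_x G x).
  rewrite (eq_bigr (fun x => G (x.1, x.2))) => [|[]//].
  rewrite -(pair_bigA _ (fun a b => G (a, b))) /=.
  by apply: eq_bigr => a _; rewrite mulr_sumr.
rewrite (reindex_inj (inv_inj hK)) /=.
transitivity (\sum_x prodw w x.1 * (prodw w x.2 * F (h x).1 (h x).2)).
  apply: eq_bigr => -[a b] _; rewrite /G /= !mulrA; congr (_ * _).
  rewrite /prodw -!big_split; apply: eq_bigr => i _; rewrite !ffunE /=.
  by case: (A i) => //; rewrite mulrC.
rewrite -(pair_bigA _ (fun a b =>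
  prodw w a * (prodw w b * F (h (a, b)).1 (h (a, b)).2))) /=.
by apply: eq_bigr => a _; rewrite mulr_sumr.
Qed.

Lemma Ex_resample (A : pred I) (F : {ffun I -> U} -> R) :
  Ex (prodw w) F =
  Ex (prodw w) (fun o => Ex (prodw w) (fun o' => F (splice A o o'))).
Proof.
rewrite -(Ex_swap A (fun o _ => F o)); apply: eq_Ex => o.
by rewrite Ex_cst //; apply: prodw_dist.
Qed.

(** Conditioning on the coordinates in [A]: a bound uniform in their frozen values holds
    unconditionally. This is how the set [J] becomes deterministic. *)
Lemma Pr_resample_le (A : pred I) (B : pred {ffun I -> U}) (d : R) :
  (forall o, Pr (prodw w) (fun o' => B (splice A o o')) <= d) ->
  Pr (prodw w) B <= d.
Proof.
move=> Bd; rewrite /Pr (Ex_resample A).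
rewrite -[leRHS](Ex_cst (prodw_dist) d).
by apply: le_Ex => //; apply: prodw_dist.
Qed.

Lemma Ex_coord (i : I) (f : U -> R) :
  Ex (prodw w) (fun o : {ffun I -> U} => f (o i)) = Ex w f.
Proof.
have := Ex_prodw (fun j u => if j == i then f u else 1).
rewrite (bigD1 i) //= big1 => [|j /negPf ji]; last by rewrite ji Ex_cst.
rewrite eqxx mulr1 => <-; apply: eq_Ex => o.
rewrite (bigD1 i) //= big1 => [|j /negPf ->] //.
by rewrite eqxx mulr1.
Qed.

Lemma Ex_prodw_on (B : pred I) (f : U -> R) :
  Ex (prodw w) (fun o : {ffun I -> U} => \prod_(i | B i) f (o i)) =
  Ex w f ^+ #|B|.
Proof.
rewrite -prodr_const [in RHS]big_mkcond /=.
transitivity (Ex (prodw w) (fun o : {ffun I -> U} =>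
    \prod_i (if B i then f (o i) else 1))).
  by apply: eq_Ex => o; rewrite big_mkcond.
rewrite (Ex_prodw (fun i u => if B i then f u else 1)) /=.
apply: eq_bigr => i _; rewrite -topredE /=.
by case: (B i) => //; rewrite Ex_cst.
Qed.

Lemma Pr_coord (i : I) (f : pred U) :
  Pr (prodw w) (fun o : {ffun I -> U} => f (o i)) = Pr w f.
Proof. exact: (Ex_coord i (fun u => (f u)%:R)). Qed.

(** The exponential parameter is part of [f] and [t], so that a negative one yields lower tails. *)
Lemma chernoff (B : pred I) (f : U -> R) (c t : R) :
  Ex w (fun u => expR (f u)) <= expR c ->
  Pr (prodw w) (fun o : {ffun I -> U} => t <= \sum_(i | B i) f (o i))
    <= expR (#|B|%:R * c - t).
Proof.
move=> fc; rewrite expRB.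
have H := @markov_le _ _ prodw_dist
  (fun o : {ffun I -> U} => \prod_(i | B i) expR (f (o i))) (expR t)
  (fun o => t <= \sum_(i | B i) f (o i)) (expR_gt0 t).
apply: le_trans (H _ _) _.
- by move=> o; apply: prodr_ge0 => i _; apply: expR_ge0.
- by move=> o; rewrite -expR_sum ler_expR.
rewrite ler_wpM2r ?invr_ge0 ?expR_ge0 // (Ex_prodw_on B (fun u => expR (f u))).
rewrite expRM_natl lerXn2r ?nnegrE ?expR_ge0 //.
by apply: Ex_ge0 => // u; apply: expR_ge0.
Qed.

Lemma Pr_none (B : pred I) (g : pred U) (c : R) : c <= Pr w g ->
  Pr (prodw w) (fun o : {ffun I -> U} => [forall (i | B i), ~~ g (o i)])
    <= expR (- (#|B|%:R * c)).
Proof.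
move=> cg.
have -> : Pr (prodw w) (fun o : {ffun I -> U} => [forall (i | B i), ~~ g (o i)]) =
   Ex (prodw w) (fun o : {ffun I -> U} => \prod_(i | B i) (~~ g (o i))%:R).
  apply: eq_Ex => o; case: forallP => [H|].
    by rewrite big1 // => i /(implyP (H i)) ->.
  move=> /forallP; rewrite negb_forall => /existsP[i].
  rewrite negb_imply => /andP[Bi gi].
  by rewrite (bigD1 i) //= (negPf gi) mul0r.
rewrite (Ex_prodw_on B (fun u => (~~ g u)%:R)) -mulrN expRM_natl.
have -> : Ex w (fun u => (~~ g u)%:R) = 1 - Pr w g by rewrite -PrC.
rewrite lerXn2r ?nnegrE ?expR_ge0 ?subr_ge0 ?Pr_le1 //.
by apply: le_trans (expR_ge1Dx _); rewrite lerD2l lerN2.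
Qed.

End ProductSpace.

(** Both signs of [t] follow from [e^t - 1 <= t e^t] and [1 + t <= e^t]. The remainder has the shape
    that the hypothesis [rho_tail] controls in expectation. *)
Lemma expR_le_quadratic (t : R) : expR t <= 1 + t + t ^+ 2 * expR `|t|.
Proof.
have e1 : expR t - 1 <= t * expR t.
  have := expR_ge1Dx (- t); rewrite expRN => h.
  have : (1 - t) * expR t <= 1.
    by rewrite -ler_pdivlMr ?expR_gt0 // div1r.
  lra.
have e2 := expR_ge1Dx t.
have [t0|t0] := leP 0 t.
  rewrite ger0_norm //; nra.
have : 1 <= expR `|t|.
  by rewrite -expR0 ler_expR.
nra.
Qed.

End FiniteProbability.

(** * Symmetrization and contraction *)

Section Symmetrization.
Context {R : realType}.

Lemma Ex_exchange (U V : finType) (w : U -> R) (w' : V -> R)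
    (F : U -> V -> R) :
  Ex w (fun u => Ex w' (F u)) = Ex w' (fun v => Ex w (F^~ v)).
Proof.
rewrite /Ex; under eq_bigr do rewrite mulr_sumr.
rewrite exchange_big; apply: eq_bigr => v _; rewrite mulr_sumr.
by apply: eq_bigr => u _; rewrite mulrCA.
Qed.

Definition coin (_ : bool) : R := 1 / 2.

Lemma coin_dist : is_dist coin.
Proof.
split; first by move=> b; rewrite /coin; lra.
rewrite big_bool /coin /=; lra.
Qed.

Definition sgb (b : bool) : R := if b then 1 else -1.

(** The base value [0] is harmless, since only exponentials are maximized. *)
Definition bmax (T : finType) (f : T -> R) : R := \big[Num.max/0]_t f t.

Lemma bmax_le (T : finType) (f : T -> R) (c : R) :
  0 <= c -> (forall t, f t <= c) -> bmax f <= c.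
Proof. by move=> c0 fc; apply: bigmax_le. Qed.

Lemma le_bmax (T : finType) (f : T -> R) t : f t <= bmax f.
Proof. exact: le_bigmax. Qed.

Lemma bmax_ge0 (T : finType) (f : T -> R) : 0 <= bmax f.
Proof. exact: bigmax_ge_id. Qed.

(* The heart of the contraction principle: [a - |x|] is below both [a + x]
   and [a - x], while [a + |x|] is one of them. *)
Lemma bmax_abs_le (T : finType) (a x : T -> R) :
  bmax (fun t => expR (a t + `|x t|)) + bmax (fun t => expR (a t - `|x t|)) <=
  bmax (fun t => expR (a t + x t)) + bmax (fun t => expR (a t - x t)).
Proof.
set P := bmax (fun t => expR (a t + x t)).
set M := bmax (fun t => expR (a t - x t)).
have P0 : 0 <= P by exact: bmax_ge0.
have M0 : 0 <= M by exact: bmax_ge0.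
have hP t : expR (a t + x t) <= P by exact: (le_bmax (fun t => expR (a t + x t))).
have hM t : expR (a t - x t) <= M by exact: (le_bmax (fun t => expR (a t - x t))).
rewrite -(addr_max_min P M); apply: lerD; apply: bmax_le.
- by rewrite le_max P0.
- move=> t; rewrite le_max; case: (ger0P (x t)) => _; first by rewrite hP.
  by rewrite hM orbT.
- by rewrite le_min P0.
move=> t; rewrite le_min (le_trans _ (hP t)) ?(le_trans _ (hM t)) //.
  by rewrite ler_expR lerD2l lerN2 ler_norm.
by rewrite ler_expR lerD2l lerNl -normrN ler_norm.
Qed.

Lemma Ex_coin_flip (I : finType) (A : pred I) (F : {ffun I -> bool} -> R) :
  Ex (prodw coin) (fun e => F [ffun i => if A i then ~~ e i else e i]) =
  Ex (prodw coin) F.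
Proof.
pose h (e : {ffun I -> bool}) := [ffun i => if A i then ~~ e i else e i].
have hK : involutive h.
  move=> e; apply/ffunP => i; rewrite !ffunE.
  by case: (A i); rewrite ?negbK.
rewrite /Ex [RHS](reindex_inj (inv_inj hK)) /=; apply: eq_bigr => e _.
by congr (_ * _); apply: eq_bigr.
Qed.

(** Pairs [e] with its flip at [i], which leaves [a] unchanged: both sides of [bmax_abs_le] appear,
    and since both signs occur, the factor [s] does not matter. *)
Lemma contraction_step (I T : finType) (i : I) (a : {ffun I -> bool} -> T -> R)
    (x : T -> R) (s : R) : s = 1 \/ s = -1 ->
  (forall (e e' : {ffun I -> bool}), (forall j, j != i -> e j = e' j) -> a e = a e') ->
  Ex (prodw coin) (fun e => bmax (fun t => expR (a e t + sgb (e i) * (s * `|x t|)))) <=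
  Ex (prodw coin) (fun e => bmax (fun t => expR (a e t + sgb (e i) * x t))).
Proof.
move=> s1 ae.
pose fl (e : {ffun I -> bool}) := [ffun j => if j == i then ~~ e j else e j].
have half F : Ex (prodw coin) F =
    1 / 2 * Ex (prodw coin) (fun e => F e + F (fl e)).
  rewrite ExD // (Ex_coin_flip (pred1 i) F); lra.
rewrite half [leRHS]half ler_wpM2l //.
apply: le_Ex => [|e]; first exact: prodw_dist coin_dist.
have -> : a (fl e) = a e.
  by apply: ae => j /negPf ji; rewrite ffunE ji.
have -> : fl e i = ~~ e i by rewrite ffunE eqxx.
have swap (f g h k : T -> R) : f =1 g -> h =1 k ->
    bmax f + bmax h = bmax g + bmax k.
  by move=> fg hk; congr (_ + _); apply: eq_bigr => t _; rewrite ?fg ?hk.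
have L b : bmax (fun t => expR (a e t + sgb b * (s * `|x t|))) +
   bmax (fun t => expR (a e t + sgb (~~ b) * (s * `|x t|))) =
   bmax (fun t => expR (a e t + `|x t|)) + bmax (fun t => expR (a e t - `|x t|)).
  case: s1 => ->; case: b; [|rewrite [RHS]addrC|rewrite [RHS]addrC|];
    by apply: swap => t; rewrite /sgb /= ?(mul1r, mulN1r) ?opprK.
have L' b : bmax (fun t => expR (a e t + sgb b * x t)) +
   bmax (fun t => expR (a e t + sgb (~~ b) * x t)) =
   bmax (fun t => expR (a e t + x t)) + bmax (fun t => expR (a e t - x t)).
  case: b; [|rewrite [RHS]addrC];
    by apply: swap => t; rewrite /sgb /= ?(mul1r, mulN1r).
rewrite L L'; exact: bmax_abs_le.
Qed.

(** The contraction principle for the 1-Lipschitz maps [x -> s i * |x|]. The fixed signs [s i] are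
    there for sums in which the columns hitting [J] count negatively. *)
Lemma abs_contraction (I T : finType) (B : pred I) (x : T -> I -> R) (s : I -> R) :
  (forall i, s i = 1 \/ s i = -1) ->
  Ex (prodw coin) (fun e : {ffun I -> bool} =>
    bmax (fun t => expR (\sum_(i | B i) sgb (e i) * (s i * `|x t i|)))) <=
  Ex (prodw coin) (fun e : {ffun I -> bool} =>
    bmax (fun t => expR (\sum_(i | B i) sgb (e i) * x t i))).
Proof.
move=> s1.
(* Hybrids: the coordinates in [l] are already linear, the others still carry the absolute value. *)
pose y (l : seq I) t i := if i \in l then x t i else s i * `|x t i|.
pose F l := Ex (prodw coin) (fun e : {ffun I -> bool} =>
    bmax (fun t => expR (\sum_(i | B i) sgb (e i) * y l t i))).
have step i l : F l <= F (i :: l).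
  case: (boolP (i \in l)) => [il|il].
    rewrite le_eqVlt; apply/orP; left; apply/eqP; apply: eq_Ex => e.
    apply: eq_bigr => t _; congr expR; apply: eq_bigr => j _.
    by rewrite /y inE; case: eqP => // ->; rewrite il.
  case: (boolP (B i)) => [Bi|Bi]; last first.
    rewrite le_eqVlt; apply/orP; left; apply/eqP; apply: eq_Ex => e.
    apply: eq_bigr => t _; congr expR; apply: eq_bigr => j Bj.
    rewrite /y inE; case: eqP => // ji; by rewrite -ji Bj in Bi.
  pose a (e : {ffun I -> bool}) t := \sum_(j | B j && (j != i)) sgb (e j) * y l t j.
  have h := @contraction_step I T i a (x^~ i) (s i) (s1 i).
  have -> : F l = Ex (prodw coin) (fun e => bmax (fun t =>
     expR (a e t + sgb (e i) * (s i * `|x t i|)))).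
    apply: eq_Ex => e; apply: eq_bigr => t _; congr expR.
    by rewrite (bigD1 i) //= addrC /y (negPf il).
  have -> : F (i :: l) = Ex (prodw coin) (fun e => bmax (fun t =>
     expR (a e t + sgb (e i) * x t i))).
    apply: eq_Ex => e; apply: eq_bigr => t _; congr expR.
    rewrite (bigD1 i) //= addrC /y inE eqxx; congr (_ + _).
    by apply: eq_bigr => j /andP[_ /negPf ji]; rewrite inE ji.
  apply: h => e e' ee'; apply/funext => t; apply: eq_bigr => j /andP[_ ji].
  by rewrite ee'.
have le l : F [::] <= F l.
  by elim: l => // i l ih; apply: le_trans ih (step i l).
have -> : Ex (prodw coin) (fun e : {ffun I -> bool} =>
    bmax (fun t => expR (\sum_(i | B i) sgb (e i) * x t i))) = F (enum I).
  apply: eq_Ex => e; apply: eq_bigr => t _; congr expR; apply: eq_bigr => i _.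
  by rewrite /y mem_enum.
exact: le.
Qed.

(** Jensen's inequality replaces the means by an independent copy, and swapping coordinates between
    the copies inserts the signs. The factor [2] on the right is the price of separating the two
    copies. *)
Lemma symmetrization (I T U : finType) (w : U -> R) (B : pred I)
    (f : T -> U -> R) : is_dist w ->
  Ex (prodw w) (fun o : {ffun I -> U} =>
    bmax (fun t => expR (\sum_(i | B i) (Ex w (f t) - f t (o i))))) <=
  Ex (prodw w) (fun o : {ffun I -> U} => Ex (prodw coin) (fun e : {ffun I -> bool} =>
    bmax (fun t => expR (\sum_(i | B i) sgb (e i) * (2 * f t (o i)))))).
Proof.
move=> w_dist.
have W := @prodw_dist R I U w w_dist.
have Co := @prodw_dist R I bool coin coin_dist.
pose D t (o o' : {ffun I -> U}) := \sum_(i | B i) (f t (o' i) - f t (o i)).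
pose Phi o o' := bmax (fun t => expR (D t o o')).
pose X (e : {ffun I -> bool}) (o : {ffun I -> U}) :=
  bmax (fun t => expR (\sum_(i | B i) sgb (e i) * (2 * f t (o i)))).
pose neg (e : {ffun I -> bool}) := [ffun i => ~~ e i].
apply: (@le_trans _ _ (Ex (prodw w) (fun o => Ex (prodw w) (Phi o)))).
  apply: le_Ex => // o; apply: bmax_le => [|t].
    by apply: Ex_ge0 => // o'; apply: bmax_ge0.
  have -> : \sum_(i | B i) (Ex w (f t) - f t (o i)) = Ex (prodw w) (D t o).
    rewrite Ex_sum; apply: eq_bigr => i _.
    rewrite (ExB _ (fun o' : {ffun I -> U} => f t (o' i))) Ex_cst //.
    by rewrite Ex_coord.
  apply: le_trans (expR_Ex W _) _; apply: le_Ex => // o'.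
  exact: (le_bmax (fun t => expR (D t o o'))).
(* Holds for each fixed sign vector; averaging over [e] comes last, when [neg e] and [e] have the
   same law. *)
have swp (e : {ffun I -> bool}) :
    Ex (prodw w) (fun o => Ex (prodw w) (Phi o)) <=
    1 / 2 * (Ex (prodw w) (X e) + Ex (prodw w) (X (neg e))).
  rewrite (Ex_swap w e Phi).
  have -> : 1 / 2 * (Ex (prodw w) (X e) + Ex (prodw w) (X (neg e))) =
     Ex (prodw w) (fun o => Ex (prodw w) (fun o' =>
       1 / 2 * (X e o' + X (neg e) o))).
    transitivity (Ex (prodw w) (fun o => 1 / 2 * (Ex (prodw w) (X e) + X (neg e) o))).
      by rewrite ExZ (ExD _ (fun=> Ex (prodw w) (X e))) (Ex_cst W).
    by apply: eq_Ex => o; rewrite ExZ (ExD _ (X e)) (Ex_cst W).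
  apply: le_Ex => // o; apply: le_Ex => // o'.
  apply: bmax_le => [|t].
    by rewrite mulr_ge0 // addr_ge0 // bmax_ge0.
  set a := \sum_(i | B i) sgb (e i) * f t (o' i).
  set b := \sum_(i | B i) sgb (neg e i) * f t (o i).
  have -> : D t (splice e o o') (splice e o' o) = a + b.
    rewrite -big_split; apply: eq_bigr => i _; rewrite !ffunE /sgb /=.
    by case: (e i) => /=; ring.
  have ea : expR (a + a) <= X e o'.
    apply: le_trans (le_bmax _ t); rewrite ler_expR -big_split le_eqVlt.
    by apply/orP; left; apply/eqP; apply: eq_bigr => i _ /=; ring.
  have eb : expR (b + b) <= X (neg e) o.
    apply: le_trans (le_bmax _ t); rewrite ler_expR -big_split le_eqVlt.
    by apply/orP; left; apply/eqP; apply: eq_bigr => i _ /=; ring.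
  (* [2 e^a e^b <= e^(2a) + e^(2b)] leaves one copy in each term. *)
  move: ea eb; rewrite !expRD; have := sqr_ge0 (expR a - expR b); nra.
rewrite -(Ex_cst Co (Ex (prodw w) (fun o => Ex (prodw w) (Phi o)))).
apply: le_trans (le_Ex Co swp) _.
rewrite ExZ ExD.
have -> : Ex (prodw coin) (fun e => Ex (prodw w) (X (neg e))) =
    Ex (prodw coin) (fun e => Ex (prodw w) (X e)).
  exact: (Ex_coin_flip predT (fun e => Ex (prodw w) (X e))).
rewrite Ex_exchange; lra.
Qed.

End Symmetrization.

(** * Lower bounds uniform over the [l_1] sphere *)

Section UniformLowerBound.
Context {R : realType}.

(** Duality of [l_1] and [l_infinity]: the form is at most the largest [|s l|], whose exponential is
    one of the summands. The right-hand side no longer depends on [v]. *)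
Lemma expR_dot_le (L : finType) (v s : L -> R) : (0 < #|L|)%N ->
  \sum_l `|v l| <= 1 ->
  expR (\sum_l v l * s l) <= \sum_l (expR (s l) + expR (- s l)).
Proof.
move=> /card_gt0P[l0 _] v1.
pose m := [arg max_(l > l0) `|s l|]%O.
have hm l : `|s l| <= `|s m|.
  by rewrite /m; case: arg_maxP => // i _; apply.
have hs : \sum_l v l * s l <= `|s m|.
  apply: (@le_trans _ _ (\sum_l `|v l| * `|s m|)).
    apply: ler_sum => l _; apply: le_trans (ler_norm _) _.
    by rewrite normrM ler_wpM2l.
  by rewrite -mulr_suml ler_piMl.
apply: (@le_trans _ _ (expR `|s m|)); first by rewrite ler_expR.
rewrite (bigD1 m) //=.
have ha : expR `|s m| <= expR (s m) + expR (- s m).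
  by case: (ger0P (s m)) => _; rewrite ?lerDl ?lerDr expR_ge0.
apply: (le_trans ha); rewrite lerDl; apply: sumr_ge0 => l _.
by rewrite addr_ge0 // expR_ge0.
Qed.

(* The supremum over [v] is made finite by choosing a witness [v o] at each point
   [o] of the finite sample space, which thus serves as the index set. *)
Lemma uniform_lower_bound (I L U : finType) (w : U -> R) (B : pred I)
    (x : L -> U -> R) (sg : U -> R) (P : (L -> R) -> Prop) (m lam c : R) :
  is_dist w -> (0 < #|L|)%N -> 0 < lam ->
  (forall u, sg u = 1 \/ sg u = -1) ->
  (forall v, P v -> \sum_l `|v l| = 1 ->
     m <= Ex w (fun u => sg u * `|\sum_l v l * x l u|)) ->
  (forall l (b : bool), Ex w (fun u => expR (sgb b * (2 * lam * x l u))) <= expR c) ->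
  Pr (prodw w) (fun o : {ffun I -> U} => `[< exists v, [/\ P v, \sum_l `|v l| = 1 &
     \sum_(i | B i) sg (o i) * `|\sum_l v l * x l (o i)| <= #|B|%:R * m / 2 ] >])
  <= 2 * #|L|%:R * expR (#|B|%:R * c - lam * (#|B|%:R * m / 2)).
Proof.
move=> w_dist L0 lam0 sg1 hm hc.
have W := @prodw_dist R I U w w_dist.
have Co := @prodw_dist R I bool coin coin_dist.
pose bad (o : {ffun I -> U}) v := [/\ P v, \sum_l `|v l| = 1 &
     \sum_(i | B i) sg (o i) * `|\sum_l v l * x l (o i)| <= #|B|%:R * m / 2 ].
have /choice[v hv] : forall o : {ffun I -> U}, exists v : L -> R,
    \sum_l `|v l| <= 1 /\ ((exists v, bad o v) -> bad o v).
  move=> o; case: (pselect (exists v, bad o v)) => [[v bv]|nb].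
    by exists v; split => //; case: bv => _ ->.
  exists (fun=> 0); split => //.
  by rewrite big1 ?ler01 // => l _; rewrite normr0.
pose g (t : {ffun I -> U}) u := \sum_l v t l * x l u.
pose f (t : {ffun I -> U}) u := lam * (sg u * `|g t u|).
rewrite expRD expRN mulrA.
set S := fun o : {ffun I -> U} =>
    bmax (fun t => expR (\sum_(i | B i) (Ex w (f t) - f t (o i)))).
apply: (@le_trans _ _ (Ex (prodw w) S / expR (lam * (#|B|%:R * m / 2)))).
  apply: markov_le => //; first exact: expR_gt0.
    by move=> o; apply: bmax_ge0.
  (* On the bad event the index [o] itself, with its witness [v o], has mean at least [m] per
     coordinate but an observed average of at most [m / 2]: the deviation is at least
     [lam * |B| * m / 2]. *)
  move=> o /asboolP bo; have [_ /(_ bo) [Pv v1 hb]] := hv o.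
  apply: le_trans (le_bmax _ o); rewrite ler_expR.
  have -> : \sum_(i | B i) (Ex w (f o) - f o (o i)) =
      lam * (#|B|%:R * Ex w (fun u => sg u * `|g o u|) -
             \sum_(i | B i) sg (o i) * `|g o (o i)|).
    rewrite sumrB mulrBr; congr (_ - _); last by rewrite mulr_sumr.
    by rewrite sumr_const ExZ -mulr_natl; ring.
  apply: ler_wpM2l; first exact: ltW.
  have := hm _ Pv v1; rewrite -/(g o) => h1.
  have h2 : #|B|%:R * m <= #|B|%:R * Ex w (fun u => sg u * `|g o u|).
    by rewrite ler_wpM2l.
  have h3 : \sum_(i | B i) sg (o i) * `|g o (o i)| <= #|B|%:R * m / 2 by [].
  lra.
rewrite ler_wpM2r ?invr_ge0 ?expR_ge0 //.
apply: le_trans (symmetrization B f w_dist) _.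
apply: (@le_trans _ _ (Ex (prodw w) (fun o : {ffun I -> U} => Ex (prodw coin) (fun e : {ffun I -> bool} =>
    bmax (fun t => expR (\sum_(i | B i) sgb (e i) * (2 * lam * g t (o i)))))))).
  apply: le_Ex => // o.
  have := @abs_contraction R I _ B (fun t i => 2 * lam * g t (o i)) (fun i => sg (o i))
    (fun i => sg1 (o i)).
  apply: le_trans; apply: le_Ex => // e.
  rewrite le_eqVlt; apply/orP; left; apply/eqP; apply: eq_bigr => t _.
  congr expR; apply: eq_bigr => i _; rewrite !normrM (gtr0_norm lam0) normr_nat /f.
  by ring.
(* For fixed signs [e] the expectation over [o] factorizes over the coordinates, and [e i] merely
   changes the sign [b] in the hypothesis on exponential moments. *)
rewrite Ex_exchange.
rewrite -[leRHS](Ex_cst Co); apply: le_Ex => // e.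
apply: (@le_trans _ _ (Ex (prodw w) (fun o : {ffun I -> U} =>
   \sum_(l : L) \sum_(b : bool) expR (\sum_(i | B i) sgb b * (sgb (e i) * (2 * lam * x l (o i))))))).
  apply: le_Ex => // o; apply: bmax_le => [|t].
    by apply: sumr_ge0 => l _; apply: sumr_ge0 => b _; apply: expR_ge0.
  have h := @expR_dot_le L (v t) (fun l => \sum_(i | B i) sgb (e i) * (2 * lam * x l (o i))) L0 (hv t).1.
  rewrite (_ : \sum_(i | B i) _ = \sum_l v t l * (\sum_(i | B i) sgb (e i) * (2 * lam * x l (o i)))); last first.
    under [RHS]eq_bigr do rewrite mulr_sumr.
    rewrite exchange_big; apply: eq_bigr => i _.
    rewrite /g !mulr_sumr; apply: eq_bigr => l _; ring.
  apply: (le_trans h); apply: ler_sum => l _.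
  rewrite big_bool /=; apply: lerD; rewrite ler_expR le_eqVlt; apply/orP; left.
    by apply/eqP; apply: eq_bigr => i _; rewrite mul1r.
  by rewrite -sumrN; apply/eqP; apply: eq_bigr => i _; rewrite mulN1r.
rewrite Ex_sum.
have -> : 2 * #|L|%:R * expR (#|B|%:R * c) =
    \sum_(l : L) \sum_(b : bool) expR c ^+ #|B|.
  rewrite expRM_natl sumr_const big_bool /= -mulr_natl; ring.
apply: ler_sum => l _; rewrite Ex_sum; apply: ler_sum => b _.
have -> : Ex (prodw w) (fun o : {ffun I -> U} =>
    expR (\sum_(i | B i) sgb b * (sgb (e i) * (2 * lam * x l (o i))))) =
  Ex (prodw w) (fun o : {ffun I -> U} => \prod_i
   (if B i then expR (sgb b * (sgb (e i) * (2 * lam * x l (o i)))) else 1)).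
  by apply: eq_Ex => o; rewrite expR_sum big_mkcond.
rewrite (Ex_prodw w (fun i u =>
   if B i then expR (sgb b * (sgb (e i) * (2 * lam * x l u))) else 1)).
rewrite -prodr_const [leRHS]big_mkcond /=; apply: ler_prod => i _.
rewrite -topredE /=; case: (B i); last by rewrite Ex_cst // ler01 lexx.
rewrite Ex_ge0 => [|//|u]; last exact: expR_ge0.
have -> : Ex w (fun u => expR (sgb b * (sgb (e i) * (2 * lam * x l u)))) =
   Ex w (fun u => expR (sgb (b == e i) * (2 * lam * x l u))).
  apply: eq_Ex => u; congr expR; rewrite /sgb.
  by case: b; case: (e i) => /=; ring.
exact: hc.
Qed.

End UniformLowerBound.

(** * One sparse random column *)

Section Coordinates.
Context {R : realType}.
Variables (I U : finType) (w : U -> R).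
Hypothesis w_dist : is_dist w.

Lemma Ex_indep_coord (i : I) (F : U -> R) (G : {ffun I -> U} -> R) :
  (forall o o' : {ffun I -> U}, (forall j, j != i -> o j = o' j) -> G o = G o') ->
  Ex (prodw w) (fun o : {ffun I -> U} => F (o i) * G o) =
  Ex w F * Ex (prodw w) G.
Proof.
move=> hG; rewrite (Ex_resample w_dist (pred1 i)).
transitivity (Ex (prodw w) (fun o : {ffun I -> U} => F (o i) * Ex (prodw w) G)).
  apply: eq_Ex => o; rewrite -ExZ; apply: eq_Ex => o'.
  rewrite ffunE /= eqxx; congr (_ * _); apply: hG => j /negPf ji.
  by rewrite ffunE /= ji.
by rewrite ExZr Ex_coord.
Qed.

Lemma Ex_sqr_sum (x : U -> R) (a : I -> R) : Ex w x = 0 ->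
  Ex (prodw w) (fun o : {ffun I -> U} => (\sum_i a i * x (o i)) ^+ 2) =
  \sum_i a i ^+ 2 * Ex w (fun u => x u ^+ 2).
Proof.
move=> x0.
transitivity (Ex (prodw w) (fun o : {ffun I -> U} =>
   \sum_i \sum_j a i * a j * (x (o i) * x (o j)))).
  apply: eq_Ex => o; rewrite expr2 mulr_suml; apply: eq_bigr => i _.
  by rewrite mulr_sumr; apply: eq_bigr => j _; ring.
rewrite Ex_sum; apply: eq_bigr => i _; rewrite Ex_sum (bigD1 i) //=.
rewrite big1 => [|j ji]; last first.
  rewrite ExZ (Ex_indep_coord x (G := fun o => x (o j))) ?x0 ?mul0r ?mulr0 //.
  by move=> o o' h; rewrite h.
rewrite addr0 ExZ -expr2; congr (_ * _).
exact: (Ex_coord w_dist i (fun u => x u * x u)).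
Qed.

End Coordinates.

Section Clip.
Context {R : realType}.

Definition clip (t : R) : R := Num.max (-1) (Num.min 1 t).

Lemma clip_le1 t : `|clip t| <= 1.
Proof.
rewrite /clip ler_norml; apply/andP; split; first by rewrite le_max lexx.
rewrite ge_max ge_min lexx /= andbT; lra.
Qed.

(** Monotonicity of [clip] makes the gain nonnegative in every case; it is exactly [a^2 / tau] when
    neither argument is clipped. *)
Lemma clip_increment (a y tau : R) : 0 < tau ->
  a * clip (y / tau) +
    a ^+ 2 / tau * ((`|a| <= tau / 2) && (`|y| <= tau / 2))%R%:R <=
  a * clip ((y + a) / tau).
Proof.
move=> tau0.
have mono u v : u <= v -> clip u <= clip v.
  by move=> uv; rewrite /clip ge_max !le_max lexx /= le_min !ge_min lexx uv !orbT.
have id u : `|u| <= 1 -> clip u = u.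
  rewrite ler_norml => /andP[h1 h2].
  by rewrite /clip (min_idPr h2) (max_idPr h1).
case: (boolP (_ && _)) => [/andP[ha hy]|_]; last first.
  rewrite mulr0 addr0; case: (lerP 0 a) => a0.
    by rewrite ler_wpM2l // mono // ler_pM2r ?invr_gt0 // lerDl.
  by rewrite ler_wnM2l ?(ltW a0) // mono // ler_pM2r ?invr_gt0 // gerDl ltW.
rewrite !id ?mulr1.
- rewrite le_eqVlt; apply/orP; left; apply/eqP; field; exact: lt0r_neq0.
- rewrite normrM normfV (gtr0_norm tau0) ler_pdivrMr // mul1r.
  by apply: le_trans (ler_normD _ _) _; lra.
- rewrite normrM normfV (gtr0_norm tau0) ler_pdivrMr // mul1r; lra.
Qed.

End Clip.

Section Column.
Context {R : realType}.
Variables (V : finType) (q rho : V -> R) (theta K : R) (n : nat).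
Hypotheses (q_dist : is_dist q) (theta01 : 0 < theta < 1) (K1 : 1 <= K).
Hypothesis rho_mean : Ex q rho = 0.
(** Half of the [1 / 10] of the model: rounding and recentering take the rest. *)
Hypothesis rho_abs : 1 / 20 <= Ex q (fun v => `|rho v|).
Hypothesis rho_tail : Ex q (fun v => rho v ^+ 2 * expR `|rho v|) <= K.

(* An entry [chi * R] is encoded by the pair of the indicator [chi = 1] and the
   cell of [R], to which [rho] assigns a representative value. *)
Definition entryw (u : bool * V) : R := (if u.1 then theta else 1 - theta) * q u.2.
Definition entry (u : bool * V) : R := if u.1 then rho u.2 else 0.

Lemma Ex_entryw (f : bool * V -> R) : Ex entryw f =
  theta * Ex q (fun v => f (true, v)) + (1 - theta) * Ex q (fun v => f (false, v)).
Proof.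
rewrite /Ex /entryw; rewrite (eq_bigr (fun u => (fun b v =>
  (if b then theta else 1 - theta) * q v * f (b, v)) u.1 u.2)) => [|[]//].
rewrite -(pair_bigA _ (fun b v => (if b then theta else 1 - theta) * q v * f (b, v))).
rewrite big_bool /=; congr (_ + _); rewrite mulr_sumr; apply: eq_bigr => v _;
  by rewrite mulrA.
Qed.

Lemma entryw_dist : is_dist entryw.
Proof.
case: q_dist => q0 q1; case/andP: theta01 => t0 t1; split.
  move=> [b v]; rewrite /entryw /= mulr_ge0 //; case: b; lra.
transitivity (Ex entryw (fun=> 1)); first by apply: eq_bigr => u _; rewrite mulr1.
rewrite Ex_entryw !(Ex_cst q_dist); ring.
Qed.

Let E_dist := entryw_dist.

Lemma Ex_active : Ex entryw (fun u => (u.1 : bool)%:R) = theta.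
Proof. rewrite Ex_entryw /= !Ex_cst //; ring. Qed.

Lemma Ex_entry : Ex entryw entry = 0.
Proof. rewrite Ex_entryw /entry /= Ex_cst // rho_mean; ring. Qed.

Let mu := Ex q (fun v => `|rho v|).

Lemma Ex_abs_entry : Ex entryw (fun u => `|entry u|) = theta * mu.
Proof. rewrite Ex_entryw /entry /= normr0 Ex_cst // /mu; ring. Qed.

Lemma Ex_entry_quad : Ex entryw (fun u => entry u ^+ 2 * expR `|entry u|) <= theta * K.
Proof.
rewrite Ex_entryw /entry /= expr0n mul0r Ex_cst // mulr0 addr0.
by rewrite ler_wpM2l //; case/andP: theta01 => /ltW.
Qed.

Lemma rho_sqr : Ex q (fun v => rho v ^+ 2) <= K.
Proof.
apply: le_trans rho_tail; apply: le_Ex => // v.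
by rewrite ler_peMr ?sqr_ge0 // -expR0 ler_expR.
Qed.

(** Stated for any [f] dominated by an entry, so as to cover the entry, its absolute value, and its
    mass restricted to columns missing a set. For [|lam| <= 1] the remainder of [expR_le_quadratic]
    is at most [lam^2] times the assumed moment. *)
Lemma Ex_exp_entry (C : finType) (wc : C -> R) (f : C -> R) (u : C -> bool * V) (lam : R) :
  is_dist wc -> `|lam| <= 1 -> (forall c, `|f c| <= `|entry (u c)|) ->
  Ex wc (fun c => entry (u c) ^+ 2 * expR `|entry (u c)|) <= theta * K ->
  Ex wc (fun c => expR (lam * f c)) <= expR (lam * Ex wc f + theta * K * lam ^+ 2).
Proof.
move=> wc_dist lam1 fu hu.
have lam2 : 0 <= lam ^+ 2 by rewrite sqr_ge0.
apply: le_trans (expR_ge1Dx _).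
apply: (@le_trans _ _ (Ex wc (fun c => 1 + (lam * f c +
    lam ^+ 2 * (entry (u c) ^+ 2 * expR `|entry (u c)|))))).
  apply: le_Ex => // c; apply: le_trans (expR_le_quadratic _) _.
  rewrite addrA lerD2l exprMn -mulrA ler_wpM2l //.
  have fu2 : f c ^+ 2 <= entry (u c) ^+ 2.
    by rewrite -(real_normK (num_real (f c))) -(real_normK (num_real (entry _))) lerXn2r ?nnegrE.
  apply: ler_pM => //; rewrite ?sqr_ge0 ?expR_ge0 //.
  by rewrite ler_expR normrM; apply: le_trans (fu c); rewrite ler_piMl.
rewrite ExD Ex_cst // ExD !ExZ lerD2l lerD2l [leRHS]mulrC ler_wpM2l //.
Qed.

Lemma Ex_exp_lin (lam : R) : `|lam| <= 1 ->
  Ex entryw (fun u => expR (lam * entry u)) <= expR (theta * K * lam ^+ 2).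
Proof.
move=> lam1; have := @Ex_exp_entry _ entryw entry id lam E_dist lam1 (fun=> lexx _) Ex_entry_quad.
by rewrite Ex_entry mulr0 add0r.
Qed.

Lemma Ex_exp_abs (lam : R) : `|lam| <= 1 ->
  Ex entryw (fun u => expR (lam * `|entry u|)) <=
  expR (lam * (theta * mu) + theta * K * lam ^+ 2).
Proof.
move=> lam1; rewrite -Ex_abs_entry.
apply: (@Ex_exp_entry _ entryw (fun u => `|entry u|) id lam E_dist lam1 _ Ex_entry_quad).
by move=> u; rewrite normr_id.
Qed.

Notation col := {ffun 'I_n -> bool * V}.
Notation colw := (prodw entryw : col -> R).

Lemma colw_dist : is_dist colw.
Proof. exact: prodw_dist. Qed.

Definition hits (J : {set 'I_n}) (c : col) : bool := [exists l in J, (c l).1].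

Lemma hits_le_sum (J : {set 'I_n}) (c : col) :
  (hits J c)%:R <= \sum_(l in J) (((c l).1 : bool)%:R : R).
Proof.
rewrite /hits; case: existsP => [[l /andP[lJ cl]]|_]; last first.
  by apply: sumr_ge0.
by rewrite (bigD1 l) //= cl lerDl; apply: sumr_ge0.
Qed.

(** A union bound over [J]: as [G] ignores the coordinates in [J], it is independent of each event
    that [l] in [J] is active. *)
Lemma Ex_hits_le (J : {set 'I_n}) (G : col -> R) :
  (forall c, 0 <= G c) ->
  (forall (l : 'I_n) (c c' : col), l \in J -> (forall j, j != l -> c j = c' j) -> G c = G c') ->
  Ex colw (fun c => (hits J c)%:R * G c) <= #|J|%:R * theta * Ex colw G.
Proof.
move=> G0 hG.
apply: (@le_trans _ _ (Ex colw (fun c => \sum_(l in J) (((c l).1 : bool)%:R) * G c))).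
  apply: le_Ex => [|c]; first exact: colw_dist.
  by rewrite -mulr_suml ler_wpM2r // hits_le_sum.
rewrite Ex_sum (eq_bigr (fun=> theta * Ex colw G)) => [|l lJ].
  by rewrite sumr_const -mulrA mulr_natl.
rewrite (Ex_indep_coord E_dist (fun u : bool * V => ((u.1 : bool)%:R)) (i := l)).
  by rewrite Ex_active.
by move=> c c' h; apply: hG lJ h.
Qed.

(** Changing the sign of the columns that hit [J] removes twice their mass, at most the proportion
    [2 * 1/4]. *)
Lemma Ex_signed_ge (J : {set 'I_n}) (G : col -> R) : #|J|%:R * theta <= 1 / 4 ->
  (forall c, 0 <= G c) ->
  (forall (l : 'I_n) (c c' : col), l \in J -> (forall j, j != l -> c j = c' j) -> G c = G c') ->
  Ex colw G / 2 <= Ex colw (fun c => (if hits J c then -1 else 1) * G c).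
Proof.
move=> J4 G0 hG.
have -> : Ex colw (fun c => (if hits J c then -1 else 1) * G c) =
   Ex colw G - 2 * Ex colw (fun c => (hits J c)%:R * G c).
  by rewrite -ExZ -ExB; apply: eq_Ex => c; case: (hits J c) => /=; ring.
have := Ex_hits_le G0 hG.
have : 0 <= Ex colw G by apply: Ex_ge0 => //; exact: colw_dist.
nra.
Qed.

(** [r <= 1/80 + 80 r^2] always, and [r <= r^2 / T] beyond [T]. Of the first moment [1/20], the
    constant and the part beyond [T] account for [1/80] each, which leaves [1/40] for 80 times the
    truncated second moment. *)
Lemma rho_sqr_trunc (T : R) : 80 * K <= T ->
  1 / 3200 <= Ex q (fun v => rho v ^+ 2 * (`|rho v| <= T)%R%:R).
Proof.
move=> hT; have T0 : 0 < T by move: K1; lra.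
have : mu <= Ex q (fun v => 1 / 80 + (80 * (rho v ^+ 2 * (`|rho v| <= T)%R%:R) +
      T^-1 * rho v ^+ 2)).
  apply: le_Ex => // v; rewrite -(real_normK (num_real (rho v))).
  set r := `|rho v|; have r0 : 0 <= r by exact: normr_ge0.
  have : 0 <= T^-1 * r ^+ 2 by rewrite mulr_ge0 ?invr_ge0 ?sqr_ge0 // ltW.
  case: (lerP r T) => rT /=.
    by have := sqr_ge0 (r - 1 / 80); nra.
  have : r <= T^-1 * r ^+ 2.
    by rewrite expr2 mulrA ler_peMl // mulrC ler_pdivlMr // mul1r ltW.
  lra.
rewrite ExD Ex_cst // ExD !ExZ.
have h : T^-1 * Ex q (fun v => rho v ^+ 2) <= 1 / 80.
  rewrite mulrC ler_pdivrMr //; have := rho_sqr; lra.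
move: rho_abs; rewrite -/mu; lra.
Qed.

(* The absolute value is tested against [clip (Y / tau)], where
   [Y = sum_l sign(v_l) X_l] and [tau] is a multiple of [sqrt (n theta)]: replacing
   [v] by its signs makes the bound insensitive to spikes of [v]. *)
Lemma Ex_linear_form_ge (v : 'I_n -> R) : 1 <= n%:R * theta ->
  theta / 6400 / (160 * K * Num.sqrt (n%:R * theta)) * \sum_l `|v l| <=
  Ex colw (fun c => `|\sum_l v l * entry (c l)|).
Proof.
move=> nt1; set r := Num.sqrt _.
have /andP[t0 t1] := theta01.
have C_dist := colw_dist.
have r2 : r ^+ 2 = n%:R * theta by rewrite sqr_sqrtr //; lra.
have r1 : 1 <= r by rewrite -sqrtr1 ler_wsqrtr.
(* [T = 80 K sqrt (n theta)] is large enough both for [rho_sqr_trunc] and for Chebyshev's inequality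
   in [PY]. *)
pose tau := 160 * K * r; pose T := tau / 2.
have hT : 80 * K <= T by rewrite /T /tau; move: K1 r1; nra.
have T0 : 0 < T by move: K1; lra.
have tau0 : 0 < tau by rewrite /T in T0; lra.
pose s l : R := if 0 <= v l then 1 else -1.
have vs l : v l = `|v l| * s l.
  by rewrite /s; case: ger0P => _; rewrite ?mulr1 // mulrN1 opprK.
have s2 l : s l ^+ 2 = 1 by rewrite /s; case: ifP => _; rewrite ?expr1n // sqrrN expr1n.
pose Y' l (c : col) := \sum_m (if m == l then 0 else s m) * entry (c m).
pose Y (c : col) := \sum_m s m * entry (c m).
have YE l c : Y c = Y' l c + s l * entry (c l).
  rewrite /Y /Y' (bigD1 l) //= [in RHS](bigD1 l) //= eqxx mul0r add0r addrC.
  by congr (_ + _); apply: eq_bigr => m /negPf ->.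
have Y'_indep l (c c' : col) : (forall j, j != l -> c j = c' j) -> Y' l c = Y' l c'.
  move=> h; apply: eq_bigr => m _; case: eqVneq => [_|ml]; first by rewrite !mul0r.
  by rewrite h.
have EX2 : Ex entryw (fun u => entry u ^+ 2) <= theta * K.
  rewrite Ex_entryw /entry /= expr0n Ex_cst // mulr0 addr0 ler_wpM2l ?(ltW t0) //.
  exact: rho_sqr.
have EX20 : 0 <= Ex entryw (fun u => entry u ^+ 2).
  by apply: Ex_ge0 => // u; apply: sqr_ge0.
have PY l : 1 / 2 <= Pr colw (fun c => `|Y' l c| <= T).
  have -> : Pr colw (fun c => `|Y' l c| <= T) = 1 - Pr colw (fun c => ~~ (`|Y' l c| <= T)).
    rewrite PrC //; lra.
  have := @markov_le _ _ colw C_dist (fun c => Y' l c ^+ 2) (T ^+ 2)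
     (fun c => ~~ (`|Y' l c| <= T)) (exprn_gt0 2 T0) (fun=> sqr_ge0 _).
  have h0 c : ~~ (`|Y' l c| <= T) -> T ^+ 2 <= Y' l c ^+ 2.
    rewrite -ltNge => /ltW h; rewrite -(real_normK (num_real (Y' l c))).
    by rewrite lerXn2r ?nnegrE // ltW.
  move=> /(_ h0).
  rewrite (Ex_sqr_sum E_dist _ Ex_entry).
  have h1 : \sum_i (if i == l then 0 else s i) ^+ 2 * Ex entryw (fun u => entry u ^+ 2)
      <= n%:R * (theta * K).
    apply: (@le_trans _ _ (\sum_(i < n) theta * K)).
      apply: ler_sum => i _; case: eqP => _; last by rewrite s2 mul1r.
      by rewrite expr0n mul0r mulr_ge0 ?ltW //; move: K1; lra.
    by rewrite sumr_const card_ord mulr_natl.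
  have h2 : n%:R * (theta * K) / T ^+ 2 <= 1 / 2.
    rewrite ler_pdivrMr ?exprn_gt0 //.
    have -> : T ^+ 2 = 6400 * K ^+ 2 * (n%:R * theta) by rewrite -r2 /T /tau; field.
    rewrite mulrA; set a := n%:R * theta in nt1 *.
    have : 0 <= a * K * (K - 1) by rewrite !mulr_ge0 //; move: K1 nt1; lra.
    have : 0 <= a * K by rewrite !mulr_ge0 //; move: K1 nt1; lra.
    rewrite expr2; lra.
  have h3 : (\sum_i (if i == l then 0 else s i) ^+ 2 * Ex entryw (fun u => entry u ^+ 2)) / T ^+ 2
      <= n%:R * (theta * K) / T ^+ 2.
    by rewrite ler_pM2r // invr_gt0 exprn_gt0.
  lra.
have PX : theta / 3200 <= Ex entryw (fun u => entry u ^+ 2 * (`|entry u| <= T)%R%:R).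
  rewrite Ex_entryw /entry /= expr0n mul0r Ex_cst // mulr0 addr0 ler_wpM2l ?(ltW t0) //.
  have := rho_sqr_trunc hT; lra.
(* The term in [clip (Y' l / tau)] has mean zero by independence and centering; what remains is the
   quadratic gain of [clip_increment]. *)
have key l : theta / 6400 / tau <= Ex colw (fun c => s l * entry (c l) * clip (Y c / tau)).
  apply: (@le_trans _ _ (Ex colw (fun c =>
      s l * entry (c l) * clip (Y' l c / tau) + tau^-1 * (entry (c l) ^+ 2 * (`|entry (c l)| <= T)%R%:R *
      (`|Y' l c| <= T)%R%:R)))); last first.
    apply: le_Ex => // c; rewrite (YE l).
    have := clip_increment (s l * entry (c l)) (Y' l c) tau0.
    rewrite exprMn s2 mul1r.
    have -> : `|s l * entry (c l)| = `|entry (c l)|.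
      by rewrite normrM /s; case: ifP => _; rewrite ?normrN normr1 mul1r.
    rewrite -/T -mulnb natrM; congr (_ + _ <= _); ring.
  rewrite ExD ExZ.
  rewrite (Ex_indep_coord E_dist (fun u => entry u ^+ 2 * (`|entry u| <= T)%R%:R)
      (G := fun c => (`|Y' l c| <= T)%R%:R) (i := l)); last by move=> c c' /Y'_indep ->.
  rewrite (Ex_indep_coord E_dist (fun u => s l * entry u)
     (G := fun c => clip (Y' l c / tau)) (i := l)); last by move=> c c' /Y'_indep ->.
  rewrite ExZ Ex_entry mulr0 mul0r add0r mulrC ler_wpM2l ?invr_ge0 ?(ltW tau0) //.
  move: (PY l) PX; rewrite -/(Pr _ _).
  set a := Ex entryw _; set b := Pr _ _; move: t0; nra.
apply: (@le_trans _ _ (\sum_l `|v l| * (theta / 6400 / tau))).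
  by rewrite -mulr_suml mulrC.
apply: (@le_trans _ _ (Ex colw (fun c => \sum_l `|v l| * (s l * entry (c l) * clip (Y c / tau))))).
  rewrite Ex_sum; apply: ler_sum => l _; rewrite ExZ ler_wpM2l //.
apply: le_Ex => // c.
have -> : \sum_l `|v l| * (s l * entry (c l) * clip (Y c / tau)) =
    (\sum_l v l * entry (c l)) * clip (Y c / tau).
  by rewrite mulr_suml; apply: eq_bigr => l _; rewrite [in RHS]vs; ring.
apply: le_trans (ler_norm _) _; rewrite normrM ler_piMr ?clip_le1 //.
Qed.

End Column.

(** * Tail bounds for the matrix *)

Section MatrixTails.
Context {R : realType}.
Variables (V : finType) (q rho : V -> R) (theta K : R) (n p : nat).
Hypotheses (q_dist : is_dist q) (theta01 : 0 < theta < 1) (K1 : 1 <= K).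
Hypothesis rho_mean : Ex q rho = 0.
Hypothesis rho_abs : 1 / 20 <= Ex q (fun v => `|rho v|).
Hypothesis rho_tail : Ex q (fun v => rho v ^+ 2 * expR `|rho v|) <= K.
Hypothesis n_theta : 1 <= n%:R * theta.

Notation col := {ffun 'I_n -> bool * V}.
Notation colw := (prodw (entryw q theta) : col -> R).
Notation mat := {ffun 'I_p -> col}.
Notation matw := (prodw colw : mat -> R).

Let E_dist : is_dist (entryw q theta).
Proof. exact: entryw_dist. Qed.
Let C_dist : is_dist colw.
Proof. exact: colw_dist. Qed.

Let mu := Ex q (fun v => `|rho v|).

Let Ex_col_abs (l : 'I_n) : Ex colw (fun c => `|entry rho (c l)|) = theta * mu.
Proof.
by rewrite (Ex_coord E_dist l (fun u => `|entry rho u|)) Ex_abs_entry.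
Qed.

Lemma row_sum_tail (l : 'I_n) :
  Pr matw (fun o => 21 / 20 * (p%:R * theta * mu) <= \sum_a `|entry rho (o a l)|)
  <= expR (- (p%:R * theta / K / 800 / 800)).
Proof.
have /andP[t0 t1] := theta01.
have K0 : 0 < K by move: K1; lra.
(* For [lam = 1 / (800 K)] the quadratic cost is [theta * lam / 800], half of the gain [lam * theta
   * mu / 20 >= theta * lam / 400]. *)
have [lam [lam0 lamE lK lam1]] : exists lam : R,
    [/\ 0 < lam, K^-1 / 800 = lam, lam * K = 1 / 800 & `|lam| <= 1].
  have iK0 : 0 < K^-1 by rewrite invr_gt0.
  have iK1 : K^-1 <= 1 by rewrite invf_le1.
  exists (K^-1 / 800); split; [lra|exact: erefl| |].
    by rewrite mulrAC mulVf; [|exact: lt0r_neq0].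
  rewrite ger0_norm; lra.
have := @chernoff R 'I_p col colw C_dist predT (fun c => lam * `|entry rho (c l)|)
  (lam * (theta * mu) + theta * K * lam ^+ 2)
  (lam * (21 / 20 * (p%:R * theta * mu))).
rewrite (Ex_coord E_dist l (fun u => expR (lam * `|entry rho u|))).
move=> /(_ (Ex_exp_abs q_dist theta01 rho_tail lam1)).
rewrite cardE /= enumT -enumT -cardE card_ord => h.
apply: (@le_trans _ _ (Pr matw (fun o : mat => lam * (21 / 20 * (p%:R * theta * mu)) <=
  \sum_(i | predT i) lam * `|entry rho (o i l)|))).
  by apply: le_Pr => [|o ho]; [exact: prodw_dist|rewrite -mulr_sumr ler_pM2l].
apply: le_trans h _; rewrite ler_expR.
have -> : p%:R * theta / K / 800 / 800 = p%:R * theta * lam / 800.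
  by rewrite -lamE !mulrA.
have -> : theta * K * lam ^+ 2 = theta * lam / 800.
  have -> : theta * K * lam ^+ 2 = theta * lam * (lam * K) by ring.
  by rewrite lK; ring.
have h0 : 0 <= p%:R * theta * lam by rewrite !mulr_ge0 // ltW.
have h1 : p%:R * theta * lam * (1 / 20) <= p%:R * theta * lam * mu.
  by rewrite ler_wpM2l.
move: h0 h1; lra.
Qed.

(** One factor [79/80] comes from leaving out the two exposed columns, another from those hitting
    [J] outside [l]. Their product exceeds [39/40], so the margin over [19/20] is [1/40];
    [lam = 1 / (1600 K)] uses up half of it. *)
Lemma single_hit_tail (J : {set 'I_n}) (l : 'I_n) (B : pred 'I_p) :
  #|J|%:R * theta <= 1 / 80 -> 79 / 80 * p%:R <= #|B|%:R :> R ->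
  Pr matw (fun o => \sum_(a | B a) `|entry rho (o a l)| * (~~ hits (J :\ l) (o a))%:R
     <= 19 / 20 * (p%:R * theta * mu))
  <= expR (- (p%:R * theta / K / 1600 / 1600)).
Proof.
move=> hJ hB.
have /andP[t0 t1] := theta01.
have K0 : 0 < K by move: K1; lra.
have [lam [lam0 lamE lK lam1]] : exists lam : R,
    [/\ 0 < lam, K^-1 / 1600 = lam, lam * K = 1 / 1600 & `|- lam| <= 1].
  have iK0 : 0 < K^-1 by rewrite invr_gt0.
  have iK1 : K^-1 <= 1 by rewrite invf_le1.
  exists (K^-1 / 1600); split; [lra|exact: erefl| |].
    by rewrite mulrAC mulVf; [|exact: lt0r_neq0].
  rewrite normrN ger0_norm; lra.
pose f (c : col) := `|entry rho (c l)| * (~~ hits (J :\ l) c)%:R.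
have mu0 : 0 <= mu by move: rho_abs; rewrite -/mu; lra.
have Ef : 79 / 80 * (theta * mu) <= Ex colw f.
  have -> : Ex colw f = theta * mu -
      Ex colw (fun c => (hits (J :\ l) c)%:R * `|entry rho (c l)|).
    rewrite -(Ex_col_abs l) -ExB; apply: eq_Ex => c; rewrite /f.
    by case: hits => /=; ring.
  have := @Ex_hits_le R V q theta n q_dist theta01 (J :\ l) (fun c => `|entry rho (c l)|)
    (fun=> normr_ge0 _).
  have hG : forall (l0 : 'I_n) (c c' : col), l0 \in J :\ l ->
    (forall j, j != l0 -> c j = c' j) -> `|entry rho (c l)| = `|entry rho (c' l)|.
    move=> l0 c c'; rewrite !inE => /andP[l0l _] -> //.
    by rewrite eq_sym.
  move=> /(_ hG); rewrite Ex_col_abs.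
  have : #|J :\ l|%:R * theta * (theta * mu) <= 1 / 80 * (theta * mu).
    rewrite ler_wpM2r ?mulr_ge0 ?(ltW t0) // (le_trans _ hJ) // ler_pM2r //.
    by rewrite ler_nat subset_leq_card // subD1set.
  lra.
have hf c : `|f c| <= `|entry rho (c l)|.
  rewrite /f normrM normr_id; case: hits => /=; rewrite ?normr1 ?normr0 ?mulr1 ?mulr0 //.
have hq : Ex colw (fun c => entry rho (c l) ^+ 2 * expR `|entry rho (c l)|) <= theta * K.
  rewrite (Ex_coord E_dist l (fun u => entry rho u ^+ 2 * expR `|entry rho u|)).
  exact: Ex_entry_quad.
have := @chernoff R 'I_p col colw C_dist B (fun c => - lam * f c) _
  (- lam * (19 / 20 * (p%:R * theta * mu))) (Ex_exp_entry C_dist lam1 hf hq) => h.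
apply: (@le_trans _ _ (Pr matw (fun o : mat => - lam * (19 / 20 * (p%:R * theta * mu)) <=
  \sum_(i | B i) - lam * f (o i)))).
  apply: le_Pr => [|o ho]; first exact: prodw_dist.
  by rewrite -mulr_sumr !mulNr lerN2 ler_pM2l.
apply: le_trans h _; rewrite ler_expR.
have -> : p%:R * theta / K / 1600 / 1600 = p%:R * theta * lam / 1600.
  by rewrite -lamE !mulrA.
have -> : theta * K * (- lam) ^+ 2 = theta * lam / 1600.
  have -> : theta * K * (- lam) ^+ 2 = theta * lam * (lam * K) by ring.
  by rewrite lK; ring.
have hBp : #|B|%:R <= p%:R :> R by rewrite ler_nat -[leqRHS]card_ord max_card.
have p0 : 0 <= p%:R :> R by [].
have tl : 0 <= theta * lam by rewrite mulr_ge0 // ltW.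
have h0 : 0 <= p%:R * theta * lam by rewrite -mulrA mulr_ge0.
have h1 : p%:R * theta * lam * (1 / 20) <= p%:R * theta * lam * mu by rewrite ler_wpM2l.
have h2 : #|B|%:R * (theta * lam) <= p%:R * (theta * lam) by rewrite ler_wpM2r.
have h3 : 79 / 80 * p%:R * (79 / 80 * (theta * mu)) <= #|B|%:R * Ex colw f.
  apply: ler_pM => //; rewrite !mulr_ge0 ?(ltW t0) //; lra.
have h4 := ler_wpM2l (ltW lam0) h3.
have h5 : 79 / 80 * p%:R * (79 / 80 * (theta * mu)) * lam >=
  39 / 40 * (p%:R * theta * lam * mu).
  have : 0 <= p%:R * theta * lam * mu by rewrite mulr_ge0.
  lra.
move: h0 h1 h2 h4 h5; lra.
Qed.

(** [m] is half of the bound of [Ex_linear_form_ge], the other half being lost to the signs in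
    [Ex_signed_ge]. *)
Lemma balanced_tail (J : {set 'I_n}) (B : pred 'I_p) (m : R) :
  m = theta / 6400 / (160 * K * Num.sqrt (n%:R * theta)) / 2 ->
  #|J|%:R * theta <= 1 / 4 -> p%:R / 2 <= #|B|%:R :> R ->
  Pr matw (fun o => `[< exists v : 'I_n -> R, [/\ forall l, l \in J -> v l = 0,
      \sum_l `|v l| = 1 &
     \sum_(a | B a) (if hits J (o a) then -1 else 1) * `|\sum_l v l * entry rho (o a l)|
       <= #|B|%:R * m / 2] >])
  <= 2 * n%:R * expR (- (p%:R * m ^+ 2 / (128 * theta * K))).
Proof.
move=> mE hJ hB.
have /andP[t0 t1] := theta01.
have K0 : 0 < K by move: K1; lra.
have r1 : 1 <= Num.sqrt (n%:R * theta) by rewrite -[leLHS]sqrtr1 ler_wsqrtr.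
have r0 : 0 < Num.sqrt (n%:R * theta) by exact: lt_le_trans ltr01 r1.
have [x x01 mx] : exists2 x : R, 0 < x <= theta & m = x / 6400 / 2.
  exists (theta / (160 * K * Num.sqrt (n%:R * theta))); last by rewrite mE; lra.
  have D1 : 1 <= 160 * K * Num.sqrt (n%:R * theta) by move: K1 r1; nra.
  set D := 160 * K * _ in D1 *; have D0 : 0 < D by exact: lt_le_trans ltr01 D1.
  by rewrite divr_gt0 //= ler_pdivrMr // ler_peMr // ltW.
have m0 : 0 < m by rewrite mx; lra.
have mt : m <= theta by rewrite mx; lra.
have {mx mE}mE2 := congr1 Some mE.
have n0 : (0 < n)%N.
  by rewrite lt0n; apply/eqP => n00; move: n_theta; rewrite n00 mul0r; lra.
(* Chosen so that the cost [theta * K * (2 lam)^2] per column is [lam * m / 4], half of the gain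
   [lam * m / 2]. *)
pose lam := m / (16 * theta * K).
have tK : 0 < 16 * theta * K.
  by apply: mulr_gt0 K0; apply: mulr_gt0 t0; rewrite ltr0n.
have lam0 : 0 < lam by rewrite divr_gt0.
have lamE : lam * theta * K = m / 16.
  rewrite /lam; field; by rewrite !lt0r_neq0.
have lam1 : 2 * lam <= 1.
  have : lam <= 1 / 16.
    rewrite /lam ler_pdivrMr //; apply: le_trans mt _.
    have : 0 <= theta * (K - 1) by rewrite mulr_ge0 ?subr_ge0 // ltW.
    lra.
  lra.
pose sg (c : col) : R := if hits J c then -1 else 1.
have := @uniform_lower_bound R 'I_p 'I_n col colw B (fun l c => entry rho (c l)) sg
  (fun v => forall l, l \in J -> v l = 0) m lam (theta * K * (2 * lam) ^+ 2) C_dist.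
rewrite card_ord => /(_ n0 lam0) h.
apply: (le_trans (h _ _ _)).
- by move=> c; rewrite /sg; case: hits; [right|left].
- move=> v vJ v1; rewrite /sg.
  have := @Ex_signed_ge R V q theta n q_dist theta01 J
    (fun c => `|\sum_l v l * entry rho (c l)|) hJ (fun=> normr_ge0 _).
  have hG : forall (l : 'I_n) (c c' : col), l \in J -> (forall j, j != l -> c j = c' j) ->
     `|\sum_l v l * entry rho (c l)| = `|\sum_l v l * entry rho (c' l)|.
    move=> l c c' lJ cc'; congr `|_|; apply: eq_bigr => j _.
    by case: (eqVneq j l) => [->|/cc' ->//]; rewrite vJ // !mul0r.
  move=> /(_ hG); apply: le_trans.
  have := Ex_linear_form_ge q_dist theta01 K1 rho_mean rho_abs rho_tail v n_theta.
  case: mE2 => ->; rewrite v1 mulr1 => h'.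
  by apply: ler_wpM2r h'; rewrite invr_ge0.
- move=> l b.
  rewrite (Ex_coord E_dist l (fun u => expR (sgb b * (2 * lam * entry rho u)))).
  have hb : `|sgb b * (2 * lam)| <= 1 :> R.
    have -> : `|sgb b * (2 * lam)| = 2 * lam.
      by rewrite normrM (gtr0_norm (mulr_gt0 _ lam0)) // /sgb; case: b; rewrite ?normrN normr1 mul1r.
    exact: lam1.
  have := Ex_exp_lin q_dist theta01 rho_mean rho_tail hb.
  have -> : (sgb b * (2 * lam)) ^+ 2 = (2 * lam) ^+ 2.
    by rewrite /sgb; case: (b); ring.
  by apply: le_trans; apply: le_Ex => // u; rewrite mulrA.
apply: ler_wpM2l; first by rewrite mulr_ge0.
rewrite ler_expR.
have -> : theta * K * (2 * lam) ^+ 2 = lam * m / 4.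
  have -> : theta * K * (2 * lam) ^+ 2 = 4 * lam * (lam * theta * K) by ring.
  by rewrite lamE; field.
have -> : p%:R * m ^+ 2 / (128 * theta * K) = p%:R * (lam * m) / 8.
  rewrite /lam; field; by rewrite !lt0r_neq0.
have := ler_wpM2r (mulr_ge0 (ltW lam0) (ltW m0)) hB.
lra.
Qed.

End MatrixTails.

(** * Columns with a dominant entry *)

Section GoodColumns.
Context {R : realType}.
Variables (V : finType) (q rho : V -> R) (theta K : R) (n : nat).
Hypotheses (q_dist : is_dist q) (theta01 : 0 < theta < 1) (K1 : 1 <= K).
Hypothesis rho_abs : 1 / 20 <= Ex q (fun v => `|rho v|).
Hypothesis rho_tail : Ex q (fun v => rho v ^+ 2 * expR `|rho v|) <= K.

(** A Paley-Zygmund argument: of the first moment [1/20], values below [1/40] contribute at most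
    [1/40], values beyond [s = 80 K] at most [K / s = 1/80], so [s] times the probability is at
    least [1/80]. *)
Lemma Pr_rho_large : 1 / (6400 * K) <= Pr q (fun v => 1 / 40 <= `|rho v|).
Proof.
have K0 : 0 < K by move: K1; lra.
pose s : R := 80 * K.
have s0 : 0 < s by rewrite /s; lra.
rewrite mul1r; have -> : 6400 * K = 80 * s by rewrite /s; lra.
have : Ex q (fun v => `|rho v|) <= Ex q (fun v =>
    1 / 40 + (s^-1 * rho v ^+ 2 + s * ((1 / 40 <= `|rho v|)%R%:R))).
  apply: le_Ex => // v; rewrite -(real_normK (num_real (rho v))).
  have r0 := normr_ge0 (rho v); set r := `|rho v| in r0 *.
  have h0 : 0 <= s^-1 * r ^+ 2 by rewrite mulr_ge0 ?sqr_ge0 // invr_ge0 ltW.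
  case: (lerP (1 / 40) r) => /= hr; last by move: h0; lra.
  case: (lerP r s) => rs; first by move: h0; lra.
  have : r <= s^-1 * r ^+ 2.
    by rewrite expr2 mulrA ler_peMl // mulrC ler_pdivlMr // mul1r ltW.
  by move: s0; lra.
rewrite ExD Ex_cst // ExD !ExZ -/(Pr _ _).
have h : s^-1 * Ex q (fun v => rho v ^+ 2) <= 1 / 80.
  rewrite mulrC ler_pdivrMr //.
  have := rho_sqr q_dist rho_tail; rewrite /s; lra.
have sP : s * (80 * s)^-1 = 1 / 80.
  by rewrite invfM mulrCA mulfV ?mulr1 ?mul1r // lt0r_neq0.
move=> h1; rewrite -(ler_pM2l s0) sP; move: h h1 rho_abs; lra.
Qed.

(* [t] is an upper [eta]-quantile of [|rho|], and [s] is the sign under which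
   at least half of the mass of [t <= |rho|] sits. *)
Lemma exists_quantile (eta : R) : 0 < eta -> eta <= 1 / (6400 * K) ->
  exists t s : R, [/\ s = 1 \/ s = -1, 1 / 40 <= t,
    eta / 2 <= Pr q (fun v => t <= s * rho v) &
    Pr q (fun v => t < `|rho v|) <= eta].
Proof.
move=> eta0 /le_trans/(_ Pr_rho_large) hP.
pose big v := eta <= Pr q (fun u => `|rho v| <= `|rho u|).
have [v1 v1P] : exists v, 1 / 40 <= `|rho v|.
  apply/not_existsP => h; suff : Pr q (fun v => 1 / 40 <= `|rho v|) = 0 by move: hP eta0; lra.
  by rewrite /Pr /Ex big1 // => v _; case: lerP => [/h//|]; rewrite mulr0.
pose v0 := [arg min_(v < v1 | 1 / 40 <= `|rho v|) `|rho v|]%O.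
have [hv0 v0min] : 1 / 40 <= `|rho v0| /\ forall v, 1 / 40 <= `|rho v| -> `|rho v0| <= `|rho v|.
  by rewrite /v0; case: arg_minP.
have bv0 : big v0 by apply: le_trans hP _; apply: le_Pr => // v /v0min.
(* The largest attained value whose upper tail, including the value itself, has mass at least [eta];
   [v0] shows that one exists and that it is at least [1/40]. *)
pose vs := [arg max_(v > v0 | big v) `|rho v|]%O.
have [bvs vsmax] : big vs /\ forall v, big v -> `|rho v| <= `|rho vs|.
  by rewrite /vs; case: arg_maxP.
pose t := `|rho vs|.
have tP : Pr q (fun v => t < `|rho v|) <= eta.
  case: (pselect (exists v, t < `|rho v|)) => [[u1 u1P]|h]; last first.
    rewrite /Pr /Ex big1 ?ltW // => v _; case: ltrP => [hv|]; last by rewrite mulr0.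
    by case: h; exists v.
  (* The next value above [t]: its closed upper tail is the open upper tail of [t], and it has mass
     below [eta] by maximality of [vs]. *)
  pose u0 := [arg min_(v < u1 | t < `|rho v|) `|rho v|]%O.
  have [hu0 u0min] : t < `|rho u0| /\ forall v, t < `|rho v| -> `|rho u0| <= `|rho v|.
    by rewrite /u0; case: arg_minP.
  case: (lerP eta (Pr q (fun u => `|rho u0| <= `|rho u|))) => [/vsmax|/ltW].
    by rewrite leNgt hu0.
  by apply: le_trans; apply: le_Pr => // v /u0min.
have hh : Pr q (fun u => t <= `|rho u|) <=
    Pr q (fun v => t <= 1 * rho v) + Pr q (fun v => t <= -1 * rho v).
  apply: le_trans (Pr_or q_dist _ _); apply: le_Pr => // v.
  by rewrite mul1r mulN1r; case: ger0P => _ ->; rewrite ?orbT.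
have t40 : 1 / 40 <= t by apply: le_trans hv0 _; apply: vsmax.
have bt : eta <= Pr q (fun u => t <= `|rho u|) by exact: bvs.
case: (lerP (eta / 2) (Pr q (fun v => t <= 1 * rho v))) => h.
  by exists t, 1; split => //; left.
exists t, (-1); split => //; first by right.
move: h hh bt; lra.
Qed.

Notation col := {ffun 'I_n -> bool * V}.
Notation colw := (prodw (entryw q theta) : col -> R).

Definition supp (c : col) : {set 'I_n} := [set l | (c l).1].

Variables (t s : R).

(** [S] is the support of a column exposed before, which may be met only in [k] (empty for the first
    column of a pair). The cap on the support is 8 times its mean size; it keeps [J] small. *)
Definition good_column (k : 'I_n) (S : {set 'I_n}) (c : col) : bool :=
  [&& (c k).1, t <= s * rho (c k).2,
      [forall l, (l != k) ==> ((c l).1 ==> (`|rho (c l).2| <= t))],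
      [forall l in S, (l != k) ==> ~~ (c l).1] &
      #|supp c|%:R <= 8 * (n%:R * theta)].

Lemma Pr_good_column (k : 'I_n) (S : {set 'I_n}) (eta : R) :
  0 < eta -> n%:R * theta * eta <= 1 / 8 -> 1 <= n%:R * theta ->
  #|S|%:R * theta <= 1 / 8 ->
  eta / 2 <= Pr q (fun v => t <= s * rho v) ->
  Pr q (fun v => t < `|rho v|) <= eta ->
  theta * eta / 4 <= Pr colw (good_column k S).
Proof.
move=> eta0 nte nt hS h1 h2.
have /andP[t0 t1] := theta01.
have E_dist : is_dist (entryw q theta) by exact: entryw_dist.
have C_dist : is_dist colw by exact: colw_dist.
set N := n%:R * theta in nte nt *.
pose A (u : bool * V) : bool := u.1 && (t <= s * rho u.2).
pose x (l : 'I_n) (c : col) : R := ((c l).1 : bool)%:R.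
pose y (l : 'I_n) (c : col) : R := ((c l).1 && (t < `|rho (c l).2|))%:R.
(* A linear minorant of the indicator of all conditions off [k]. It ignores coordinate [k], so its
   mean multiplies the probability of the condition at [k]; the three subtracted means are at most
   [1/8], [1/8] and [1/4]. *)
pose G (c : col) : R := 1 - (\sum_(l | l != k) y l c +
   (\sum_(l | (l \in S) && (l != k)) x l c + (4 * N)^-1 * \sum_(l | l != k) x l c)).
have x0 l c : 0 <= x l c by [].
have y0 l c : 0 <= y l c by [].
have N0 : 0 < N by lra.
have N4 : 0 < 4 * N by lra.
have iN0 : 0 < (4 * N)^-1 by rewrite invr_gt0.
have EA : theta * eta / 2 <= Ex (entryw q theta) (fun u => (A u)%:R).
  rewrite Ex_entryw /A /= [X in (1 - theta) * X]Ex_cst // mulr0 addr0 -mulrA.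
  by rewrite ler_pM2l.
have Ex_x l : Ex colw (x l) = theta.
  by rewrite (Ex_coord E_dist l (fun u : bool * V => (u.1 : bool)%:R)) Ex_active.
have Ex_y l : Ex colw (y l) <= theta * eta.
  rewrite (Ex_coord E_dist l (fun u : bool * V => (u.1 && (t < `|rho u.2|))%:R)).
  by rewrite Ex_entryw /= [X in (1 - theta) * X]Ex_cst // mulr0 addr0 ler_pM2l.
have sum_le (Q : pred 'I_n) (f : 'I_n -> R) b : 0 <= b -> (forall l, f l <= b) ->
    \sum_(l | Q l) f l <= n%:R * b.
  move=> b0 fb; apply: (@le_trans _ _ (\sum_(l < n) b)).
    rewrite [leRHS](bigID Q) /=; apply: le_trans (ler_sum _ (fun l _ => fb l)) _.
    by rewrite lerDl sumr_ge0.
  by rewrite sumr_const card_ord mulr_natl.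
have EG : 1 / 2 <= Ex colw G.
  rewrite /G ExB Ex_cst // ExD ExD ExZ !Ex_sum.
  have g1 : \sum_(l | l != k) Ex colw (y l) <= n%:R * (theta * eta).
    by apply: sum_le => // ; rewrite mulr_ge0 // ltW.
  have g2 : \sum_(l | (l \in S) && (l != k)) Ex colw (x l) <= #|S|%:R * theta.
    rewrite (eq_bigr (fun=> theta)) // [leRHS]mulr_natl -sumr_const.
    rewrite big_mkcondr /=; apply: ler_sum => l _; case: ifP => // _; exact: ltW.
  have g3 : (4 * N)^-1 * \sum_(l | l != k) Ex colw (x l) <= 1 / 4.
    rewrite mulrC ler_pdivrMr //.
    have : \sum_(l | l != k) Ex colw (x l) <= N.
      by apply: sum_le; rewrite ?ltW // => l; rewrite Ex_x.
    lra.
  move: g1 g2 g3 nte hS; rewrite mulrA -/N; lra.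
have key : Ex colw (fun c => (A (c k))%:R * G c) =
    Ex (entryw q theta) (fun u => (A u)%:R) * Ex colw G.
  apply: (Ex_indep_coord E_dist (fun u => (A u)%:R)) => c c' cc'.
  rewrite /G /x /y; congr (1 - (_ + (_ + _ * _))); apply: eq_bigr => l.
  - by move=> lk; rewrite cc'.
  - by move=> /andP[_ lk]; rewrite cc'.
  - by move=> lk; rewrite cc'.
apply: (@le_trans _ _ (Ex colw (fun c => (A (c k))%:R * G c))).
  rewrite key; move: EA EG (mulr_ge0 (ltW t0) (ltW eta0)).
  set a := Ex _ _; set b := Ex _ _; set d := theta * eta; nra.
apply: le_Ex => // c.
have Sy0 : 0 <= \sum_(l | l != k) y l c by apply: sumr_ge0.
have Sx0 (Q : pred 'I_n) : 0 <= \sum_(l | Q l) x l c by apply: sumr_ge0.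
have Sz0 : 0 <= (4 * N)^-1 * \sum_(l | l != k) x l c by rewrite mulr_ge0 // ltW.
pose D := [&& [forall l, (l != k) ==> ((c l).1 ==> (`|rho (c l).2| <= t))],
      [forall l in S, (l != k) ==> ~~ (c l).1] & #|supp c|%:R <= 8 * N].
have -> : good_column k S c = A (c k) && D by rewrite /good_column /A -andbA.
case: (boolP (A (c k))) => [Ak|]; last by rewrite mul0r.
rewrite mul1r /=; case: (boolP D) => [_|].
  by rewrite /G; move: Sy0 (Sx0 [pred l | (l \in S) && (l != k)]) Sz0 => /=; lra.
rewrite !negb_and => /or3P[].
- rewrite negb_forall => /existsP[l]; rewrite !negb_imply => /and3P[lk cl tl].
  have : 1 <= \sum_(l | l != k) y l c.
    rewrite (bigD1 l) //= /y cl ltNge tl lerDl; exact: sumr_ge0.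
  by rewrite /G /=; move: (Sx0 [pred l | (l \in S) && (l != k)]) Sz0 => /=; lra.
- rewrite negb_forall => /existsP[l]; rewrite !negb_imply => /and4P[lS lk cl _].
  have : 1 <= \sum_(l | (l \in S) && (l != k)) x l c.
    by rewrite (bigD1 l) ?lS //= /x cl lerDl; apply: sumr_ge0.
  by rewrite /G /=; move: Sy0 Sz0; lra.
rewrite -ltNge => hsz.
have : #|supp c|%:R = 1 + \sum_(l | l != k) x l c :> R.
  rewrite -sum1_card natr_sum big_mkcond /= (bigD1 k) //= inE; case/andP: Ak => -> _.
  by congr (_ + _); apply: eq_bigr => l _; rewrite inE /x; case: (c l).1.
(* A support larger than [8 N] has more than [8 N - 1 >= 4 N] elements other than [k]. *)
have : (4 * N)^-1 * (8 * N - 1) >= 1.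
  by rewrite mulrC ler_pdivlMr //; lra.
move=> h3 h4.
have h5 : (4 * N)^-1 * (8 * N - 1) <= (4 * N)^-1 * \sum_(l | l != k) x l c.
  by rewrite ler_pM2l //; lra.
by rewrite /G /=; move: (Sx0 [pred l | (l \in S) && (l != k)]) Sy0 h3 h5 => /=; lra.
Qed.

End GoodColumns.

(** * Pairs of columns meeting only in row [k] *)

Section GoodPairs.
Context {R : realType}.
Variables (V : finType) (q rho : V -> R) (theta K : R) (n p : nat).
Hypotheses (q_dist : is_dist q) (theta01 : 0 < theta < 1) (K1 : 1 <= K).
Hypothesis rho_mean : Ex q rho = 0.
Hypothesis rho_abs : 1 / 20 <= Ex q (fun v => `|rho v|).
Hypothesis rho_tail : Ex q (fun v => rho v ^+ 2 * expR `|rho v|) <= K.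
Hypothesis n_theta : 1 <= n%:R * theta.
(** [1280 = 16 * 80]: two good columns have at most [16 n theta] active rows, so
    [|J| theta <= 1/80]. Likewise [160 <= p] makes two columns at most [1/80] of all. *)
Hypothesis n_theta2 : n%:R * theta ^+ 2 <= 1 / 1280.
Hypothesis p_large : (160 <= p)%N.

Notation col := {ffun 'I_n -> bool * V}.
Notation colw := (prodw (entryw q theta) : col -> R).
Notation mat := {ffun 'I_p -> col}.
Notation matw := (prodw colw : mat -> R).

Let E_dist : is_dist (entryw q theta).
Proof. exact: entryw_dist. Qed.
Let C_dist : is_dist colw.
Proof. exact: colw_dist. Qed.
Let M_dist : is_dist matw.
Proof. exact: prodw_dist. Qed.

Definition pair_supp (o : mat) (i j : 'I_p) : {set 'I_n} := supp (o i) :|: supp (o j).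

Definition pair_sum (o : mat) (i j : 'I_p) (l : 'I_n) : R :=
  entry rho (o i l) + entry rho (o j l).

Definition row_sum (o : mat) (l : 'I_n) : R := \sum_a `|entry rho (o a l)|.

(* Mass of row [l] in the columns that hit [J] at most in [l]. *)
Definition single_sum (o : mat) (J : {set 'I_n}) (l : 'I_n) : R :=
  \sum_a `|entry rho (o a l)| * (~~ hits (J :\ l) (o a))%:R.

Definition signed_sum (o : mat) (J : {set 'I_n}) (v : 'I_n -> R) : R :=
  \sum_a (if hits J (o a) then -1 else 1) * `|\sum_l v l * entry rho (o a l)|.

(** Conditions (a)-(c) with slack to absorb the rounding: [1/2] in place of [2/3], and positive
    margins in the two comparisons of sums. *)
Definition good_pair (m : R) (o : mat) (k : 'I_n) (i j : 'I_p) : Prop :=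
  let J := pair_supp o i j in let b := pair_sum o i j in
  [/\ (i < j)%N, k \in J,
      1 / 20 <= `|b k| /\ (forall l, l != k -> `|b l| <= `|b k| / 2),
      (forall v, (forall l, l \in J -> v l = 0) -> \sum_l `|v l| = 1 ->
         p%:R * m / 4 <= signed_sum o J v) &
      (forall l, l \in J -> l != k ->
         3 / 400 * (p%:R * theta) <=
           2 * single_sum o J l - row_sum o l - 2 / 3 * row_sum o k)].

Variables (t s : R).

(** Once the columns in [B1] are frozen, either none is good, or a good one [i] has a fixed support,
    small enough to serve as [S] for the fresh columns in [B2]. *)
Lemma Pr_no_good_pair (k : 'I_n) (eta : R) (B1 B2 : pred 'I_p) :
  0 < eta -> n%:R * theta * eta <= 1 / 8 ->
  eta / 2 <= Pr q (fun v => t <= s * rho v) ->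
  Pr q (fun v => t < `|rho v|) <= eta ->
  (forall a, B1 a -> ~~ B2 a) ->
  Pr matw (fun o => [forall (i | B1 i), good_column rho theta t s k finset.set0 (o i) ==>
     [forall (j | B2 j), ~~ good_column rho theta t s k (supp (o i)) (o j)]])
  <= expR (- (#|B1|%:R * (theta * eta / 4))) + expR (- (#|B2|%:R * (theta * eta / 4))).
Proof.
move=> eta0 nte h1 h2 B12.
have /andP[t0 t1] := theta01.
set good := good_column rho theta t s k.
have Pgood (S : {set _}) : #|S|%:R * theta <= 1 / 8 -> theta * eta / 4 <= Pr colw (good S).
  by move=> hS; apply: (Pr_good_column q_dist theta01 k eta0).
have suppS (S : {set _}) c : good S c -> #|supp c|%:R * theta <= 1 / 8.
  move=> /and5P[_ _ _ _]; rewrite -(ler_pM2r t0) => /le_trans; apply.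
  by move: n_theta2; lra.
pose none (o : mat) := [forall (i | B1 i), ~~ good finset.set0 (o i)].
set d := expR (- (#|B2|%:R * _)).
rewrite /Pr (Ex_resample C_dist B1).
apply: (@le_trans _ _ (Ex matw (fun o => (none o)%:R + d))); last first.
  rewrite ExD Ex_cst // lerD2r.
  by apply: (Pr_none C_dist); apply: Pgood; rewrite cards0 mul0r.
apply: le_Ex => // o; have d0 : 0 <= d by exact: expR_ge0.
case: (boolP (none o)) => [_|].
  apply: (@le_trans _ _ 1); last by rewrite lerDl.
  rewrite -[leRHS](Ex_cst M_dist 1); apply: le_Ex => // o'.
  by rewrite lern1 leq_b1.
rewrite /none negb_forall => /existsP[i]; rewrite negb_imply negbK => /andP[Bi gi].
rewrite add0r.
apply: (@le_trans _ _ (Pr matw (fun o' : mat =>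
    [forall (j | B2 j), ~~ good (supp (o i)) (o' j)]))).
  apply: (le_Pr M_dist) => o' /forallP/(_ i).
  rewrite ffunE Bi /= => /implyP/(_ gi)/forallP h.
  apply/forallP => j; apply/implyP => Bj; have := implyP (h j) Bj.
  by rewrite ffunE; case: (boolP (B1 j)) => // /B12; rewrite Bj.
by apply: (Pr_none C_dist); apply: Pgood; apply: suppS gi.
Qed.

Let off (i j : 'I_p) : pred 'I_p := fun a => (a != i) && (a != j).

Let card_off i j : p%:R - 2 <= #|off i j|%:R :> R.
Proof.
have : (p <= #|off i j| + 2)%N.
  rewrite -[leqLHS]card_ord -(cardC (off i j)) leq_add2l.
  apply: leq_trans (card_size [:: i; j]); apply: subset_leq_card.
  by apply/fintype.subsetP => a; rewrite !inE /off /in_mem /= negb_and !negbK.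
by rewrite -(ler_nat R) natrD; lra.
Qed.

Let p160 : 160 <= p%:R :> R.
Proof. by rewrite ler_nat. Qed.

(** The bound on [|J|] is part of the event: with columns [i] and [j] frozen it is either false, and
    the probability is zero, or available to [single_hit_tail]. *)
Lemma Pr_pair_single (i j : 'I_p) :
  Pr matw (fun o => (#|pair_supp o i j|%:R * theta <= 1 / 80) &&
    [exists l, \sum_(a | off i j a) `|entry rho (o a l)| *
        (~~ hits (pair_supp o i j :\ l) (o a))%:R
     <= 19 / 20 * (p%:R * theta * Ex q (fun v => `|rho v|))])
  <= n%:R * expR (- (p%:R * theta / K / 1600 / 1600)).
Proof.
apply: (Pr_resample_le C_dist (A := pred2 i j)) => o.
pose J := pair_supp o i j.
have JE o' : pair_supp (splice (pred2 i j) o o') i j = J.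
  by rewrite /pair_supp !ffunE /= !eqxx orbT.
case: (lerP (#|J|%:R * theta) (1 / 80)) => hJ; last first.
  rewrite /Pr /Ex big1 => [|o' _]; first by rewrite mulr_ge0 ?expR_ge0.
  by rewrite JE leNgt hJ mulr0.
pose bd := 19 / 20 * (p%:R * theta * Ex q (fun v => `|rho v|)).
apply: (@le_trans _ _ (Pr matw (fun o' => [exists l,
    \sum_(a | off i j a) `|entry rho (o' a l)| * (~~ hits (J :\ l) (o' a))%:R <= bd]))).
  apply: (le_Pr M_dist) => o' /andP[_ /existsP[l hl]]; apply/existsP; exists l.
  apply: le_trans hl; rewrite le_eqVlt; apply/orP; left; apply/eqP.
  apply: eq_bigr => a /andP[/negPf ai /negPf aj].
  by rewrite JE !ffunE /= ai aj.
apply: le_trans (Pr_exists M_dist _) _.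
rewrite -[n in leRHS]card_ord mulr_natl -sumr_const; apply: ler_sum => l _.
apply: single_hit_tail => //; apply: le_trans (card_off i j).
move: p160; lra.
Qed.

Lemma Pr_pair_balanced (i j : 'I_p) (m : R) :
  m = theta / 6400 / (160 * K * Num.sqrt (n%:R * theta)) / 2 ->
  Pr matw (fun o => (#|pair_supp o i j|%:R * theta <= 1 / 4) &&
    `[< exists v : 'I_n -> R, [/\ forall l, l \in pair_supp o i j -> v l = 0,
      \sum_l `|v l| = 1 &
     \sum_(a | off i j a) (if hits (pair_supp o i j) (o a) then -1 else 1) *
        `|\sum_l v l * entry rho (o a l)| <= #|off i j|%:R * m / 2] >])
  <= 2 * n%:R * expR (- (p%:R * m ^+ 2 / (128 * theta * K))).
Proof.
move=> mE.
apply: (Pr_resample_le C_dist (A := pred2 i j)) => o.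
pose J := pair_supp o i j.
have JE o' : pair_supp (splice (pred2 i j) o o') i j = J.
  by rewrite /pair_supp !ffunE /= !eqxx orbT.
case: (lerP (#|J|%:R * theta) (1 / 4)) => hJ; last first.
  rewrite /Pr /Ex big1 => [|o' _]; first by rewrite !mulr_ge0 ?expR_ge0.
  by rewrite JE leNgt hJ mulr0.
have hB : p%:R / 2 <= #|off i j|%:R :> R.
  apply: le_trans (card_off i j); move: p160; lra.
apply: le_trans (balanced_tail q_dist theta01 K1 rho_mean rho_abs rho_tail n_theta mE hJ hB).
apply: (le_Pr M_dist) => o' /andP[_ /asboolP[v [vJ v1 hv]]]; apply/asboolP.
exists v; split => //; first by move=> l lJ; apply: vJ; rewrite JE.
apply: le_trans hv; rewrite le_eqVlt; apply/orP; left; apply/eqP.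
apply: eq_bigr => a /andP[/negPf ai /negPf aj].
by rewrite JE !ffunE /= ai aj.
Qed.

Lemma good_pair_of_columns (k : 'I_n) (i j : 'I_p) (o : mat) (m : R) :
  0 <= m -> s = 1 \/ s = -1 -> 1 / 40 <= t -> (i < j)%N ->
  good_column rho theta t s k finset.set0 (o i) ->
  good_column rho theta t s k (supp (o i)) (o j) ->
  (forall l, row_sum o l < 21 / 20 * (p%:R * theta * Ex q (fun v => `|rho v|))) ->
  (#|pair_supp o i j|%:R * theta <= 1 / 80 -> forall l,
     19 / 20 * (p%:R * theta * Ex q (fun v => `|rho v|)) <
     \sum_(a | off i j a) `|entry rho (o a l)| *
        (~~ hits (pair_supp o i j :\ l) (o a))%:R) ->
  (#|pair_supp o i j|%:R * theta <= 1 / 4 -> forall v : 'I_n -> R,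
     (forall l, l \in pair_supp o i j -> v l = 0) -> \sum_l `|v l| = 1 ->
     #|off i j|%:R * m / 2 <=
     \sum_(a | off i j a) (if hits (pair_supp o i j) (o a) then -1 else 1) *
        `|\sum_l v l * entry rho (o a l)|) ->
  good_pair m o k i j.
Proof.
move=> m0 s1 t40 ij gi gj hrow hsingle hsigned.
have /andP[t0 t1] := theta01.
set J := pair_supp o i j in hsingle hsigned *.
have /and5P[ci ti /forallP si _ ni] := gi.
have /and5P[cj tj /forallP sj /forallP dj nj] := gj.
have hJ : #|J|%:R * theta <= 1 / 80.
  apply: (@le_trans _ _ ((16 * (n%:R * theta)) * theta)); last first.
    by move: n_theta2; lra.
  rewrite ler_pM2r //; apply: (@le_trans _ _ ((#|supp (o i)| + #|supp (o j)|)%N%:R)).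
    by rewrite ler_nat cardsU leq_subr.
  by rewrite natrD; lra.
have kJ : k \in J by rewrite !inE ci.
(* Columns [i] and [j] live on [J], where [v] vanishes; leaving them out costs nothing. *)
have off_term a (v : 'I_n -> R) : (forall l, l \in J -> v l = 0) -> ~~ off i j a ->
    \sum_l v l * entry rho (o a l) = 0.
  move=> vJ; rewrite /off negb_and !negbK => aij; apply: big1 => l _.
  rewrite /entry; case: (boolP (o a l).1) => [al|_]; last by rewrite mulr0.
  rewrite vJ ?mul0r // !inE.
  by case/orP: aij => /eqP <-; rewrite al ?orbT.
split=> //.
(* The common sign [s] makes the two entries add up at [k], while off [k] at most one of the columns
   is active. *)
- have bk : 2 * t <= `|pair_sum o i j k|.
    rewrite /pair_sum /entry ci cj.
    case: s1 ti tj => ->; rewrite ?mul1r ?mulN1r => ti tj.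
      by apply: le_trans (ler_norm _); lra.
    by rewrite -normrN; apply: le_trans (ler_norm _); lra.
  split=> [|l lk]; first by move: bk t40; lra.
  suff : `|pair_sum o i j l| <= t by move: bk; lra.
  have sml (c : col) : (l != k) ==> ((c l).1 ==> (`|rho (c l).2| <= t)) ->
      `|entry rho (c l)| <= t.
    rewrite lk /= /entry; case: (c l).1 => //= _.
    by rewrite normr0; move: t40; lra.
  rewrite /pair_sum; case: (boolP (o i l).1) => il.
    have := dj l; rewrite inE il lk /= => jl.
    by rewrite [X in _ + X]/entry (negPf jl) addr0; apply: sml; apply: si.
  by rewrite [X in X + _]/entry (negPf il) add0r; apply: sml; apply: sj.
- move=> v vJ v1.
  have -> : signed_sum o J v = \sum_(a | off i j a) (if hits J (o a) then -1 else 1) *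
        `|\sum_l v l * entry rho (o a l)|.
    rewrite /signed_sum (bigID (off i j)) /= [X in _ + X]big1 ?addr0 // => a aij.
    by rewrite off_term // normr0 mulr0.
  apply: le_trans (hsigned _ v vJ v1); last by move: hJ; lra.
  have := ler_wpM2r m0 (card_off i j); have := ler_wpM2r m0 p160; lra.
(* [2 * 19/20 - 21/20 - 2/3 * 21/20 = 3/20], and the mean [1/20] turns this into the margin
   [3/400]. *)
move=> l lJ lk.
have h1 := hsingle hJ l.
have h2 : \sum_(a | off i j a) `|entry rho (o a l)| * (~~ hits (J :\ l) (o a))%:R <=
    single_sum o J l.
  rewrite /single_sum [leRHS](bigID (off i j)) /= lerDl.
  by apply: sumr_ge0 => a _; apply: mulr_ge0.
have h3 := hrow l; have h4 := hrow k.
have h5 : p%:R * theta * (1 / 20) <= p%:R * theta * Ex q (fun v => `|rho v|).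
  by rewrite ler_wpM2l // mulr_ge0 // ltW.
move: h1 h2 h3 h4 h5; lra.
Qed.

End GoodPairs.

Lemma card_lower_half (p : nat) : #|[pred a : 'I_p | (a < p./2)%N]| = p./2.
Proof.
have hp : (p./2 <= p)%N by rewrite -[leqRHS](odd_double_half p) -addnn addnA leq_addl.
by rewrite -sum1_card (big_ord_narrow hp) sum1_card card_ord.
Qed.

Lemma card_upper_half (p : nat) : #|[pred a : 'I_p | ~~ (a < p./2)%N]| = uphalf p.
Proof.
apply: (@addnI p./2); rewrite uphalf_half addnCA addnn odd_double_half.
rewrite -{1}card_lower_half -[RHS]card_ord -(cardC [pred a : 'I_p | (a < p./2)%N]).
by congr (_ + _)%N; apply: eq_card => a; rewrite !inE.
Qed.

(** * Union bound over the failure events *)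

Section FiniteModel.
Context {R : realType}.
Variables (V : finType) (q rho : V -> R) (theta K : R) (n p : nat).
Hypotheses (q_dist : is_dist q) (theta01 : 0 < theta < 1) (K1 : 1 <= K).
Hypothesis rho_mean : Ex q rho = 0.
Hypothesis rho_abs : 1 / 20 <= Ex q (fun v => `|rho v|).
Hypothesis rho_tail : Ex q (fun v => rho v ^+ 2 * expR `|rho v|) <= K.
Hypothesis n_theta : 1 <= n%:R * theta.
Hypothesis n_theta2 : n%:R * theta ^+ 2 <= 1 / 1280.
Hypothesis p_large : (160 <= p)%N.

Notation col := {ffun 'I_n -> bool * V}.
Notation colw := (prodw (entryw q theta) : col -> R).
Notation mat := {ffun 'I_p -> col}.
Notation matw := (prodw colw : mat -> R).

(** [3 n] counts the events attached to a row ([F1] twice, [F2] once), [3 n p^2] those attached to a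
    pair ([F3] once and [F4] twice for each row). *)
Lemma Pr_good_pairs (m x eta : R) :
  m = theta / 6400 / (160 * K * Num.sqrt (n%:R * theta)) / 2 -> 0 <= m ->
  0 < eta -> eta <= 1 / (6400 * K) -> n%:R * theta * eta <= 1 / 8 ->
  x <= p%:R * theta / K / 1600 / 1600 ->
  x <= p%:R * m ^+ 2 / (128 * theta * K) ->
  x <= p%:R / 4 * (theta * eta / 4) ->
  Pr matw (fun o => ~~ `[< forall k, exists i j, good_pair rho theta m o k i j >]) <=
    3 * n%:R * (1 + p%:R ^+ 2) * expR (- x).
Proof.
move=> mE m0 eta0 eta_le nte x1 x2 x3.
have /andP[t0 t1] := theta01.
have E_dist : is_dist (entryw q theta) by exact: entryw_dist.
have C_dist : is_dist colw by exact: colw_dist.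
have M_dist : is_dist matw by exact: prodw_dist.
have [t [s [s1 t40 h1 h2]]] := exists_quantile q_dist K1 rho_abs rho_tail eta0 eta_le.
set e := expR (- x).
have e0 : 0 <= e by exact: expR_ge0.
have le_e y : x <= y -> expR (- y) <= e by move=> xy; rewrite ler_expR lerN2.
pose mu := Ex q (fun v => `|rho v|).
pose off (i j : 'I_p) : pred 'I_p := fun a => (a != i) && (a != j).
pose F4 (ij : 'I_p * 'I_p) (o : mat) := (#|pair_supp o ij.1 ij.2|%:R * theta <= 1 / 4) &&
    `[< exists v : 'I_n -> R, [/\ forall l, l \in pair_supp o ij.1 ij.2 -> v l = 0,
      \sum_l `|v l| = 1 &
     \sum_(a | off ij.1 ij.2 a) (if hits (pair_supp o ij.1 ij.2) (o a) then -1 else 1) *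
        `|\sum_l v l * entry rho (o a l)| <= #|off ij.1 ij.2|%:R * m / 2] >].
have P4 ij : Pr matw (F4 ij) <= 2 * n%:R * e.
  apply: le_trans (Pr_pair_balanced q_dist theta01 K1 rho_mean rho_abs rho_tail n_theta p_large ij.1 ij.2 mE) _.
  by rewrite ler_wpM2l // ?le_e // mulr_ge0.
clear x2 mE.
pose F2 l (o : mat) := 21 / 20 * (p%:R * theta * mu) <= row_sum rho o l.
pose F3 (ij : 'I_p * 'I_p) (o : mat) :=
  (#|pair_supp o ij.1 ij.2|%:R * theta <= 1 / 80) &&
    [exists l, \sum_(a | off ij.1 ij.2 a) `|entry rho (o a l)| *
        (~~ hits (pair_supp o ij.1 ij.2 :\ l) (o a))%:R
     <= 19 / 20 * (p%:R * theta * mu)].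
have P3 ij : Pr matw (F3 ij) <= n%:R * e.
  apply: le_trans (Pr_pair_single n q_dist theta01 K1 rho_abs rho_tail p_large ij.1 ij.2) _.
  by rewrite ler_wpM2l // le_e.
have P2 l : Pr matw (F2 l) <= e.
  apply: le_trans (row_sum_tail p q_dist theta01 K1 rho_abs rho_tail l) _.
  apply: le_e; apply: le_trans x1 _.
  have : 0 <= p%:R * theta / K.
    by apply: divr_ge0; [apply: mulr_ge0 => //; exact: ltW|exact: le_trans ler01 K1].
  lra.
clear x1 eta_le.
pose B1 := [pred a : 'I_p | (a < p./2)%N].
pose B2 := [pred a : 'I_p | ~~ (a < p./2)%N].
have cB1 : p%:R / 4 <= #|B1|%:R :> R.
  have : (p <= 4 * #|B1|)%N.
    rewrite card_lower_half -[leqLHS]odd_double_half -mul2n -[4%N]/(2 + 2)%N mulnDl.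
    apply: leq_add; last by [].
    apply: (@leq_trans 1); first exact: leq_b1.
    by rewrite muln_gt0 half_gt0 (leq_trans _ p_large).
  by rewrite -(ler_nat R) natrM; lra.
have cB2 : p%:R / 4 <= #|B2|%:R :> R.
  apply: le_trans cB1 _; rewrite ler_nat card_lower_half card_upper_half.
  by rewrite uphalf_half leq_addl.
pose F1 k (o : mat) := [forall (i | B1 i), good_column rho theta t s k finset.set0 (o i) ==>
     [forall (j | B2 j), ~~ good_column rho theta t s k (supp (o i)) (o j)]].
have P1 k : Pr matw (F1 k) <= 2 * e.
  apply: le_trans (Pr_no_good_pair q_dist theta01 n_theta n_theta2 k
    eta0 nte h1 h2 (B1 := B1) (B2 := B2) _) _; first by move=> a /= ->.
  have te0 : 0 <= theta * eta / 4 by rewrite divr_ge0 // mulr_ge0 // ltW.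
  have -> : 2 * e = e + e by ring.
  by apply: lerD; apply: le_e; apply: le_trans x3 _; apply: ler_wpM2r.
clear x3.
apply: (@le_trans _ _ (Pr matw (fun o => ([exists k, F1 k o] || [exists l, F2 l o]) ||
    ([exists ij, F3 ij o] || [exists ij, F4 ij o])))).
  apply: (le_Pr M_dist) => o; apply: contraNT; rewrite !negb_or !negb_exists.
  move=> /andP[/andP[/forallP n1 /forallP n2] /andP[/forallP n3 /forallP n4]].
  apply/asboolP => k.
  move: (n1 k); rewrite negb_forall => /existsP[i]; rewrite !negb_imply => /and3P[Bi gi].
  rewrite negb_forall => /existsP[j]; rewrite negb_imply negbK => /andP[Bj gj].
  exists i, j; apply: (good_pair_of_columns theta01 rho_abs n_theta2 p_large m0 s1 t40 _ gi gj).
  - by move: Bi Bj; rewrite /= -leqNgt; exact: leq_trans.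
  - by move=> l; rewrite ltNge; exact: n2.
  - move=> hJ l; rewrite ltNge; apply/negP => hl.
    have /negP := n3 (i, j); apply; rewrite /F3 hJ /=.
    by apply/existsP; exists l.
  - move=> hJ v vJ v1; rewrite leNgt; apply/negP => hv.
    have /negP := n4 (i, j); apply; rewrite /F4 hJ /=.
    by apply/asboolP; exists v; split => //; exact: ltW.
have -> : 3 * n%:R * (1 + p%:R ^+ 2) * e =
  (n%:R * (2 * e) + n%:R * e) + ((p * p)%N%:R * (n%:R * e) + (p * p)%N%:R * (2 * n%:R * e)) :> R.
  by rewrite natrM; ring.
apply: le_trans (Pr_or M_dist _ _) _; apply: lerD;
  apply: le_trans (Pr_or M_dist _ _) _; apply: lerD;
  apply: le_trans (Pr_exists M_dist _) _.
- by rewrite mulr_natl -[n in leRHS]card_ord -sumr_const; apply: ler_sum => k _.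
- by rewrite mulr_natl -[n in leRHS]card_ord -sumr_const; apply: ler_sum => k _.
- rewrite mulr_natl.
  have -> : (p * p)%N = #|{: 'I_p * 'I_p}| by rewrite card_prod card_ord.
  by rewrite -sumr_const; apply: ler_sum => ij _.
- rewrite mulr_natl.
  have -> : (p * p)%N = #|{: 'I_p * 'I_p}| by rewrite card_prod card_ord.
  by rewrite -sumr_const; apply: ler_sum => ij _.
Qed.

End FiniteModel.

(** * Recovery from a good pair of columns *)

Section Deterministic.
Context {R : realType}.
Variables (n p : nat) (X : 'I_n -> 'I_p -> R) (chi : 'I_n -> 'I_p -> bool).
Variables (J : {set 'I_n}) (k : 'I_n) (b : 'I_n -> R).
Hypothesis X_chi : forall l a, ~~ chi l a -> X l a = 0.
Hypothesis kJ : k \in J.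
Hypothesis b_J : forall l, l \notin J -> b l = 0.
Hypothesis bk : b k != 0.
Hypothesis b_gap : forall l, l != k -> `|b l| <= 2 / 3 * `|b k|.

Definition touches (S : {set 'I_n}) (a : 'I_p) : bool := [exists l in S, chi l a].

Definition l1image (z : 'I_n -> R) : R := \sum_a `|\sum_l z l * X l a|.

Definition signed_image (v : 'I_n -> R) : R :=
  \sum_a (if touches J a then -1 else 1) * `|\sum_l v l * X l a|.

Definition abs_row (l : 'I_n) : R := \sum_a `|X l a|.

Definition lone_row (l : 'I_n) : R :=
  \sum_a `|X l a| * (~~ touches (J :\ l) a)%:R.

Hypothesis off_support : forall v, (forall l, l \in J -> v l = 0) ->
  \sum_l `|v l| = 1 -> 0 < signed_image v.
Hypothesis on_support : forall l, l \in J -> l != k ->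
  2 / 3 * abs_row k < 2 * lone_row l - abs_row l.

Lemma not_touches (S : {set 'I_n}) a l : ~~ touches S a -> l \in S -> X l a = 0.
Proof.
move=> h lS; apply: X_chi; apply: contra h => la.
by apply/existsP; exists l; rewrite lS.
Qed.

(** If the column misses [J] except possibly in some [l0 != k], its entry at [k] vanishes and
    equality holds. Otherwise every weight in the sum is [- |X l a|], and this is the triangle
    inequality. *)
Lemma column_on_support (u : 'I_n -> R) (a : 'I_p) :
  (forall l, l \notin J -> u l = 0) ->
  `|u k| * `|X k a| + \sum_(l in J :\ k) `|u l| *
     (2 * (`|X l a| * (~~ touches (J :\ l) a)%:R) - `|X l a|)
  <= `|\sum_l u l * X l a|.
Proof.
move=> uJ.
have sumJ : \sum_l u l * X l a = u k * X k a + \sum_(l in J :\ k) u l * X l a.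
  rewrite (bigD1 k) //=; congr (_ + _).
  rewrite [RHS]big_mkcond [LHS]big_mkcond /=; apply: eq_bigr => l _.
  by rewrite !inE; case: (l == k) => //=; case: (boolP (l \in J)) => // /uJ ->; rewrite mul0r.
case: (pselect (exists2 l0, l0 \in J :\ k & ~~ touches (J :\ l0) a)) => [[l0 l0J hl0]|h].
  have l0k : k != l0 by move: l0J; rewrite !inE eq_sym => /andP[].
  have z l : l \in J -> l != l0 -> X l a = 0.
    by move=> lJ ll0; apply: (not_touches hl0); rewrite !inE ll0.
  rewrite sumJ z // mulr0 normr0 mulr0 !add0r.
  rewrite (bigD1 l0) //= [in leRHS](bigD1 l0) //= !big1 ?addr0.
  - by rewrite hl0 mulr1 normrM; have -> : 2 * `|X l0 a| - `|X l0 a| = `|X l0 a| by ring.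
  - by move=> l /andP[]; rewrite !inE => /andP[_ lJ] ll0; rewrite z // mulr0.
  - move=> l /andP[]; rewrite !inE => /andP[_ lJ] ll0.
    by rewrite z // normr0 mul0r mulr0 subrr mulr0.
have -> : \sum_(l in J :\ k) `|u l| * (2 * (`|X l a| * (~~ touches (J :\ l) a)%:R) - `|X l a|)
   = - \sum_(l in J :\ k) `|u l * X l a|.
  rewrite -sumrN; apply: eq_bigr => l lJ; rewrite normrM.
  case: (boolP (touches (J :\ l) a)) => hl /=; first by ring.
  by case: h; exists l.
rewrite sumJ -normrM.
have h1 : `|\sum_(l in J :\ k) u l * X l a| <= \sum_(l in J :\ k) `|u l * X l a|.
  exact: ler_norm_sum.
by apply: le_trans (lerB_normD _ _); rewrite lerD2l lerN2.
Qed.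

Lemma l1image_on_support (u : 'I_n -> R) : (forall l, l \notin J -> u l = 0) ->
  `|u k| * abs_row k + \sum_(l in J :\ k) `|u l| * (2 * lone_row l - abs_row l)
  <= l1image u.
Proof.
move=> uJ; apply: le_trans (ler_sum _ (fun a _ => column_on_support a uJ)).
rewrite big_split /= -mulr_sumr lerD2l exchange_big /= le_eqVlt.
apply/orP; left; apply/eqP; apply: eq_bigr => l _.
by rewrite -mulr_sumr sumrB -mulr_sumr.
Qed.

(** Column by column: if it misses [J], the part of [z] on [J] contributes nothing; otherwise the
    reverse triangle inequality applies. *)
Lemma l1image_split (z : 'I_n -> R) :
  l1image (fun l => if l \in J then z l else 0) +
  signed_image (fun l => if l \in J then 0 else z l) <= l1image z.
Proof.
rewrite /l1image /signed_image -big_split /=; apply: ler_sum => a _.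
set U := \sum_l _; set Y := \sum_l _.
have -> : \sum_l z l * X l a = U + Y.
  rewrite -big_split; apply: eq_bigr => l _.
  by case: (l \in J) => /=; rewrite mul0r ?addr0 ?add0r.
case: (boolP (touches J a)) => ha; first by rewrite mulN1r lerB_normD.
rewrite (_ : U = 0) ?normr0 ?mul1r ?add0r //; apply: big1 => l _.
by case: ifP => [lJ|_]; rewrite ?mul0r // (not_touches ha) // mulr0.
Qed.

Lemma signed_image_ge0 (v : 'I_n -> R) : (forall l, l \in J -> v l = 0) ->
  0 <= signed_image v ?= iff [forall l, v l == 0].
Proof.
move=> vJ; case: (boolP [forall l, v l == 0]) => [/forallP v0|].
  have -> : signed_image v = 0; last by split; rewrite ?eqxx.
  apply: big1 => a _; rewrite big1 ?normr0 ?mulr0 // => l _.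
  by rewrite (eqP (v0 l)) mul0r.
rewrite negb_forall => /existsP[l vl].
have N0 : 0 < \sum_l `|v l|.
  by rewrite (bigD1 l) //= ltr_wpDr ?normr_gt0 // sumr_ge0.
suff h : 0 < signed_image v by split; [exact: ltW|rewrite lt_eqF].
pose N := \sum_l `|v l|.
have := @off_support (fun l => v l / N).
have -> : signed_image (fun l => v l / N) = signed_image v / N.
  rewrite /signed_image mulr_suml; apply: eq_bigr => a _; rewrite -mulrA; congr (_ * _).
  have -> : \sum_l v l / N * X l a = (\sum_l v l * X l a) / N.
    by rewrite mulr_suml; apply: eq_bigr => m _; rewrite mulrAC.
  by rewrite normrM normfV (gtr0_norm N0).
rewrite pmulr_lgt0 ?invr_gt0 //; apply=> [m /vJ ->|]; first by rewrite mul0r.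
rewrite (eq_bigr (fun m => `|v m| / N)) => [|m _].
  by rewrite -mulr_suml mulfV // gt_eqF.
by rewrite normrM normfV (gtr0_norm N0).
Qed.

(** The value at [z] is at least [abs_row k / |b k|] plus a weighted [l_1] norm of [z] on [J :\ k]
    plus the signed image of [z] off [J]. Both excesses are nonnegative, so they vanish, and each
    vanishes only at zero. *)
Lemma l1image_min (z : 'I_n -> R) : \sum_l b l * z l = 1 ->
  l1image z <= abs_row k / `|b k| -> forall l, l != k -> z l = 0.
Proof.
move=> bz hz.
pose u l := if l \in J then z l else 0.
pose y l := if l \in J then 0 else z l.
have uJ l : l \notin J -> u l = 0 by rewrite /u => /negPf ->.
have yJ l : l \in J -> y l = 0 by rewrite /y => ->.
have h1 := l1image_split z; have h2 := l1image_on_support uJ.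
have [h3 h3e] := signed_image_ge0 yJ.
rewrite -/u -/y in h1.
have bk0 : 0 < `|b k| by rewrite normr_gt0.
have Ak : 0 <= abs_row k by apply: sumr_ge0.
(* By the gap in [b], the constraint lets mass at [l] replace at most [2/3] of that mass at [k]. *)
have huk : 1 / `|b k| - 2 / 3 * \sum_(l in J :\ k) `|u l| <= `|u k|.
  have e : b k * u k = 1 - \sum_(l in J :\ k) b l * u l.
    rewrite -bz (bigD1 k) //= /u kJ -addrA.
    rewrite [X in X - _](_ : _ = \sum_(l in J :\ k) b l * (if l \in J then z l else 0)) ?subrr ?addr0 //.
    rewrite [RHS]big_mkcond [LHS]big_mkcond /=; apply: eq_bigr => l _.
    by rewrite !inE; case: (l == k) => //=; case: (boolP (l \in J)) => // /b_J ->; rewrite mul0r.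
  have e2 : `|\sum_(l in J :\ k) b l * u l| <= 2 / 3 * `|b k| * \sum_(l in J :\ k) `|u l|.
    apply: le_trans (ler_norm_sum _ _ _) _; rewrite mulr_sumr; apply: ler_sum => l.
    by rewrite !inE => /andP[lk _]; rewrite normrM ler_wpM2r // b_gap.
  have e3 : 1 <= `|b k| * `|u k| + 2 / 3 * `|b k| * \sum_(l in J :\ k) `|u l|.
    rewrite -normrM e; set S := \sum_(l in J :\ k) b l * u l in e2 *.
    have : 1 - S <= `|1 - S| by apply: ler_norm.
    have : S <= `|S| by apply: ler_norm.
    move: e2; lra.
  rewrite -(ler_pM2l bk0) mulrBr mulrCA mulfV ?gt_eqF // mulr1.
  move: e3; lra.
(* The net cost of a unit of mass at [l], after the saving at [k]. *)
pose g l := 2 * lone_row l - abs_row l - 2 / 3 * abs_row k.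
have hg l : l \in J :\ k -> 0 < g l.
  by rewrite !inE => /andP[lk lJ]; have := on_support lJ lk; rewrite /g; lra.
have h4 : abs_row k / `|b k| + \sum_(l in J :\ k) `|u l| * g l <=
    `|u k| * abs_row k + \sum_(l in J :\ k) `|u l| * (2 * lone_row l - abs_row l).
  have := ler_wpM2r Ak huk.
  have -> : \sum_(l in J :\ k) `|u l| * g l =
     \sum_(l in J :\ k) `|u l| * (2 * lone_row l - abs_row l) -
     2 / 3 * (\sum_(l in J :\ k) `|u l|) * abs_row k.
    rewrite mulrAC mulr_sumr -sumrB; apply: eq_bigr => l _; rewrite /g; ring.
  rewrite mulrBl mul1r [_^-1 * _]mulrC; lra.
have S0 : 0 <= \sum_(l in J :\ k) `|u l| * g l.
  by apply: sumr_ge0 => l /hg /ltW gl; rewrite mulr_ge0.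
have [Seq0 yeq0] : \sum_(l in J :\ k) `|u l| * g l = 0 /\ signed_image y = 0.
  by move: h1 h2 h3 h4 S0 hz; split; lra.
have y0 l : y l = 0.
  by move: h3e; rewrite yeq0 eqxx => /esym/forallP/(_ l)/eqP.
move=> l lk; case: (boolP (l \in J)) => lJ; last first.
  by have := y0 l; rewrite /y (negPf lJ).
have lJk : l \in J :\ k by rewrite !inE lk.
have /(psumr_eq0P (P := fun l => l \in J :\ k)) := Seq0.
move=> /(_ _ l lJk) h.
have : `|u l| * g l = 0 by apply: h => m /hg /ltW gm; rewrite mulr_ge0.
move/eqP; rewrite mulf_eq0 (gt_eqF (hg l lJk)) orbF normr_eq0 => /eqP.
by rewrite /u lJ.
Qed.

Lemma l1image_row (c : R) : l1image (fun l => if l == k then c else 0) = `|c| * abs_row k.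
Proof.
rewrite /l1image mulr_sumr; apply: eq_bigr => a _.
rewrite (bigD1 k) //= big1 ?addr0 => [|l /negPf ->]; last by rewrite mul0r.
by rewrite eqxx normrM.
Qed.

(** Minimality follows from [l1image_min] without compactness: a competitor that does at least as
    well is supported at [k], and the constraint then makes it the candidate. *)
Lemma l1image_lower (z : 'I_n -> R) : \sum_l b l * z l = 1 ->
  abs_row k / `|b k| <= l1image z.
Proof.
move=> bz; case: (lerP (l1image z) (abs_row k / `|b k|)) => [hz|/ltW//].
have z0 := l1image_min bz hz.
have zk : z k = (b k)^-1.
  move: bz; rewrite (bigD1 k) //= big1 ?addr0 => [h|l /z0 ->]; last by rewrite mulr0.
  by apply: (mulfI bk); rewrite h mulfV.
have -> : z = (fun l => if l == k then (b k)^-1 else 0).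
  by apply/funext => l; case: eqP => [->//|/eqP/z0].
by rewrite l1image_row normfV mulrC.
Qed.

End Deterministic.

(** * Change of variables from [w] to [z] *)

Section Recovery.
Context {R : realType}.
Variables (n p : nat) (A : 'M[R]_n) (X : 'M[R]_(n, p)).
Hypothesis A_unit : A \in unitmx.

Lemma l1norm_change (w : 'cV[R]_n) :
  l1norm (w^T *m (A *m X)) = l1image X (fun l => (A^T *m w) l 0).
Proof.
apply: eq_bigr => a _; congr `|_|; rewrite mulmxA -[w^T *m A]trmxK trmx_mul trmxK.
by rewrite mxE; apply: eq_bigr => l _; rewrite mxE.
Qed.

Lemma feasible_change (i j : 'I_p) (w : 'cV[R]_n) :
  erspud_feasible (A *m X) i j w <->
  \sum_l (X l i + X l j) * (A^T *m w) l 0 = 1.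
Proof.
rewrite /erspud_feasible; set s := \sum_l _.
have -> // : ((col i (A *m X) + col j (A *m X))^T *m w) 0 0 = s.
rewrite !colE -!mulmxA -!colE; have -> : A *m col i X + A *m col j X = A *m (col i X + col j X).
  by rewrite mulmxDr.
rewrite trmx_mul -mulmxA mxE; apply: eq_bigr => l _.
by rewrite !mxE.
Qed.

(** The first condition on [z] ensures that the pair is not skipped, the second that any minimizer,
    whichever is selected, returns a multiple of row [k]. *)
Lemma erspud_recovers_of_unique :
  (forall k : 'I_n, exists i j : 'I_p, [/\ (i < j)%N, X k i + X k j != 0,
     (forall z, \sum_l (X l i + X l j) * z l = 1 ->
        abs_row X k / `|X k i + X k j| <= l1image X z) &
     (forall z, \sum_l (X l i + X l j) * z l = 1 ->
        l1image X z <= abs_row X k / `|X k i + X k j| ->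
        forall l, l != k -> z l = 0)]) ->
  erspud_recovers (A *m X) X.
Proof.
move=> H sel run k; have [i [j [ij bk low uniq]]] := H k.
have At : A^T \in unitmx by rewrite unitmx_tr.
pose z0 : 'cV[R]_n := \col_l (if l == k then (X k i + X k j)^-1 else 0).
pose w0 := invmx A^T *m z0.
have Aw0 : A^T *m w0 = z0 by rewrite mulKVmx.
have feas0 : erspud_feasible (A *m X) i j w0.
  apply/feasible_change; rewrite Aw0 (bigD1 k) //= big1 => [|l /negPf lk].
    by rewrite mxE eqxx addr0 mulfV.
  by rewrite mxE lk mulr0.
have val0 : l1norm (w0^T *m (A *m X)) = abs_row X k / `|X k i + X k j|.
  rewrite l1norm_change Aw0 mulrC -normfV -l1image_row.
  by apply: eq_bigr => a _; congr `|_|; apply: eq_bigr => l _; rewrite mxE.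
have min0 : erspud_minimizer (A *m X) i j w0.
  split=> // w' /feasible_change; rewrite val0 l1norm_change; exact: low.
have ex : exists w, erspud_minimizer (A *m X) i j w by exists w0.
have [/feasible_change feas minS] := run i j ij ex.
have := minS w0 feas0; rewrite val0 l1norm_change => /(uniq _ feas) z0'.
exists i, j; split=> //.
set z := A^T *m sel i j in feas z0' *.
have zk : (X k i + X k j) * z k 0 = 1.
  by rewrite -[RHS]feas (bigD1 k) //= big1 ?addr0 // => l /z0' ->; rewrite mulr0.
exists (z k 0); split.
  by apply/eqP => zk0; move: zk; rewrite zk0 mulr0 => /eqP; rewrite eq_sym oner_eq0.
rewrite mulmxA -[_ *m A]trmxK trmx_mul trmxK -/z; apply/rowP => a.
rewrite !mxE (bigD1 k) //= big1 ?addr0 ?mxE // => l /z0' h.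
by rewrite mxE h mul0r.
Qed.

End Recovery.

(** * Discretization of the entries *)

Section FiniteLaw.
Context d (T : measurableType d) (R : realType) (P : probability T R).
Variables (V : finType) (g : T -> V).
Hypothesis mg : forall v, measurable [set w | g w = v].

Definition law (v : V) : R := fine (P [set w | g w = v]).

Lemma law_fin (v : V) : P [set w | g w = v] = (law v)%:E.
Proof. by rewrite /law fineK // fin_num_measure. Qed.

Lemma integral_law (f : V -> R) :
  (\int[P]_w (f (g w))%:E = (Ex law f)%:E)%E.
Proof.
pose h v w : \bar R := ((f v)%:E * (\1_[set w | g w = v] w)%:E)%E.
have ih v : P.-integrable setT (fun w => (\1_[set w | g w = v] w)%:E : \bar R).
  by apply: integrable_indic => //; rewrite (le_lt_trans (probability_le1 _ _)) ?ltry.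
transitivity (\int[P]_w (\sum_(v : V) h v w))%E.
  apply: eq_integral => w _; rewrite /h (bigD1 (g w)) //= big1 => [|v vg].
    by rewrite indicE mem_set // mule1 adde0.
  by rewrite indicE memNset ?mule0 // => /= e; rewrite -e eqxx in vg.
rewrite integral_sum //; last by move=> v; apply: integrableZl => //; exact: ih.
rewrite /Ex -sumEFin; apply: eq_bigr => v _; rewrite /h integralZl //.
rewrite integral_indic // setIT EFinM muleC; congr (_ * _)%E; exact: law_fin.
Qed.

Lemma measurable_law (S : pred V) : measurable [set w | S (g w)].
Proof.
have -> : [set w | S (g w)] = \bigcup_(v in [set v | S v]) [set w | g w = v].
  by apply/seteqP; split=> [w /= Sw|w [v /= Sv gw]]; [exists (g w)|rewrite /= gw].
by apply: fin_bigcup_measurable => // ; exact: finite_finset.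
Qed.

Lemma probability_law (S : pred V) : P [set w | S (g w)] = (Pr law S)%:E.
Proof.
rewrite /Pr -integral_law -[LHS]/(P _) -[X in P X]setIT -integral_indic //; last exact: measurable_law.
apply: eq_integral => w _; rewrite indicE; congr ((_ : bool)%:R%:E).
by apply/idP/idP => [/set_mem//|Sw]; rewrite inE.
Qed.

Lemma law_dist : is_dist law.
Proof.
split=> [v|]; first by rewrite fine_ge0.
have := probability_law predT; rewrite (_ : [set w | _] = setT); last first.
  by apply/seteqP; split.
rewrite probability_setT => -[->]; rewrite /Pr /Ex.
by apply: eq_bigr => v _; rewrite mulr1.
Qed.

End FiniteLaw.

Section Cells.
Context {R : realType}.
Variable M : nat.

(* Cells of width [1/M] cover [[-M, M[]; [ord_max] collects all other points and
   gets the junk value [0]. *)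
Definition cell (x : R) : 'I_(2 * M * M).+1 :=
  if - M%:R <= x < M%:R then inord (Num.truncn ((x + M%:R) * M%:R)) else ord_max.

Definition cval (v : 'I_(2 * M * M).+1) : R :=
  if (v < 2 * M * M)%N then v%:R / M%:R - M%:R else 0.

Hypothesis M0 : (0 < M)%N.

Let Mp : 0 < M%:R :> R. Proof. by rewrite ltr0n. Qed.

Lemma cell_in (x : R) : - M%:R <= x < M%:R ->
  (cell x < 2 * M * M)%N /\
  (cell x)%:R <= (x + M%:R) * M%:R < (cell x).+1%:R.
Proof.
move=> hx; rewrite /cell hx; case/andP: hx => x1 x2.
have y0 : 0 <= (x + M%:R) * M%:R by rewrite mulr_ge0 //; lra.
have hlt : (Num.truncn ((x + M%:R) * M%:R) < 2 * M * M)%N.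
  rewrite truncn_lt_nat // natrM; rewrite ltr_pM2r // natrM; lra.
by rewrite inordK ?truncn_itv // ltnS ltnW.
Qed.

Lemma cell_out (x : R) : ~~ (- M%:R <= x < M%:R) -> cell x = ord_max.
Proof. by rewrite /cell => /negPf ->. Qed.

Lemma cell_lt (x : R) : (cell x < 2 * M * M)%N = (- M%:R <= x < M%:R).
Proof.
case: (boolP (- M%:R <= x < M%:R)) => [/cell_in[]//|/cell_out ->].
by rewrite /= ltnn.
Qed.

Lemma cval_close (x : R) : - M%:R <= x < M%:R ->
  `|cval (cell x) - x| <= M%:R^-1.
Proof.
move=> hx; have [h1 /andP[h2 h3]] := cell_in hx; rewrite /cval h1.
have h2' : (cell x)%:R / M%:R <= x + M%:R by rewrite ler_pdivrMr.
have h3' : x + M%:R <= (cell x)%:R / M%:R + M%:R^-1.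
  by rewrite -[X in _ <= _ + X]mul1r -mulrDl natr1 ler_pdivlMr // ltW.
rewrite ler_norml; lra.
Qed.

Lemma cval_cell_le (x : R) : `|cval (cell x)| <= `|x| + M%:R^-1.
Proof.
case: (boolP (- M%:R <= x < M%:R)) => [/cval_close h|/cell_out ->].
  rewrite -[cval _](subrK x) addrC; apply: le_trans (ler_normD _ _) _.
  by rewrite lerD2l.
by rewrite /cval /= ltnn normr0 addr_ge0 // invr_ge0.
Qed.

Lemma measurable_cell (v : 'I_(2 * M * M).+1) : measurable [set x : R | cell x = v].
Proof.
case: (ltnP v (2 * M * M)) => hv.
  rewrite (_ : [set x | _] = [set` `[v%:R / M%:R - M%:R, v.+1%:R / M%:R - M%:R[ ]).
    exact: measurable_itv.
  have iM : 0 < M%:R^-1 :> R by rewrite invr_gt0.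
  have key (x : R) : (v%:R / M%:R - M%:R <= x < v.+1%:R / M%:R - M%:R) =
      (v%:R <= (x + M%:R) * M%:R < v.+1%:R).
    by rewrite lerBlDr ltrBrDr ler_pdivrMr // ltr_pdivlMr.
  apply/seteqP; split=> x /=; rewrite in_itv /= key; [move=> cx|move=> /andP[h1 h2]].
    have : (cell x < 2 * M * M)%N by rewrite cx.
    by rewrite cell_lt => /cell_in[_]; rewrite cx.
  have hx : - M%:R <= x < M%:R.
    have : 0 <= (x + M%:R) * M%:R by apply: le_trans h1.
    rewrite pmulr_lge0 // => h; have : (x + M%:R) * M%:R < (2 * M * M)%N%:R.
      by apply: (lt_le_trans h2); rewrite ler_nat.
    rewrite natrM ltr_pM2r // natrM => h'; lra.
  apply: val_inj; have [_ /andP[h3 h4]] := cell_in hx.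
  by apply/eqP; rewrite eqn_leq; apply/andP; split; rewrite -ltnS -(ltr_nat R);
    [exact: le_lt_trans h3 h2|exact: le_lt_trans h1 h4].
rewrite (_ : [set x | _] = ~` [set` `[- M%:R, M%:R[ ]).
  by apply: measurableC; exact: measurable_itv.
have -> : v = ord_max by apply: val_inj; apply/eqP; rewrite eqn_leq hv -ltnS ltn_ord.
apply/seteqP; split=> x /=; rewrite in_itv /=; [move=> cx|by move/negP/cell_out].
by rewrite -cell_lt cx /= ltnn.
Qed.

End Cells.

Lemma cval_cell_cvg (R : realType) (x : R) :
  (fun k => cval (cell k.+1 x)) @ \oo --> x.
Proof.
apply/cvgrPdist_le => e e0; near=> k.
have hk : `|x| < k.+1%:R.
  by apply: (@lt_trans _ _ k%:R); rewrite ?ltr_nat //; near: k; exact: nbhs_infty_gtr.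
rewrite distrC; apply: le_trans (cval_close _ _) _ => //.
  by move: hk; rewrite ltr_norml => /andP[/ltW -> ->].
rewrite invf_ple ?posrE //; apply: (@le_trans _ _ k%:R); rewrite ?ler_nat //.
by near: k; exact: nbhs_infty_ger.
Unshelve. all: by end_near. Qed.

Section Discretize.
Context d (T : measurableType d) (R : realType) (P : probability T R).
Variable X : {RV P >-> R}.

Lemma measurable_cell_RV (M : nat) v : (0 < M)%N ->
  measurable [set w | cell M (X w) = v].
Proof.
move=> M0; rewrite (_ : [set w | _] = X @^-1` [set x | cell M x = v]) //.
by apply: measurable_funPTI; exact: measurable_cell.
Qed.

Notation celllaw M := (law P (fun w => cell M (X w))).

(** By convention [+oo - +oo] is [-oo], so a zero mean forces the integrals of both the positive and
    the negative part to be finite. *)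
Lemma integrable_of_mean0 : ('E_P[X] = 0)%E -> P.-integrable setT (fun w => (X w)%:E).
Proof.
rewrite expectation_def integralE => h.
set f : T -> \bar R := fun w => (X w)%:E in h *.
have mX : measurable_fun setT f by apply/measurable_EFinP; exact: measurable_funPT.
have pos0 : (0 <= \int[P]_x f^\+ x)%E by apply: integral_ge0.
have neg0 : (0 <= \int[P]_x f^\- x)%E by apply: integral_ge0.
apply/integrableP; split => //.
have -> : (\int[P]_x `|f x| = \int[P]_x f^\+ x + \int[P]_x f^\- x)%E.
  rewrite -ge0_integralD //; [|exact: measurable_funepos|exact: measurable_funeneg].
  by apply: eq_integral => x _; rewrite -[in LHS]/((abse \o f) x) fune_abse.
move: h pos0 neg0; move: (\int[P]_x f^\+ x)%E (\int[P]_x f^\- x)%E.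
by move=> [a| |] [b| |] //=; rewrite ltry.
Qed.

(** Dominated convergence, with dominating function [|X| + 1], for the identity and for the absolute
    value. The floor [m0] lets the caller also prescribe range and mesh. *)
Lemma discretize (eps : R) (m0 : nat) : 0 < eps -> ('E_P[X] = 0)%E ->
  ((1 / 10)%:E <= \int[P]_w (`|X w|)%:E)%E ->
  exists M, [/\ (m0 <= M)%N, (0 < M)%N,
    `|Ex (celllaw M) (@cval R M)| <= eps &
    1 / 10 - eps <= Ex (celllaw M) (fun v => `|cval v|)].
Proof.
move=> eps0 EX0 absX.
have iX := integrable_of_mean0 EX0.
have mf k (F : R -> R) : measurable_fun setT (fun w => (F (cval (cell k.+1 (X w))))%:E).
  move=> _ B mB; rewrite setTI.
  have := @measurable_law _ T _ (fun w => cell k.+1 (X w)) (fun v => measurable_cell_RV v (ltn0Sn k))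
     (fun v => `[< B (F (cval v))%:E >]).
  by congr measurable; apply/seteqP; split => w /= /asboolP.
have cv w := @cval_cell_cvg R (X w).
have ig : P.-integrable setT (fun w => `|(X w)%:E| + 1%:E)%E.
  apply: integrableD => //; first exact: integrable_abse iX.
  by apply: finite_measure_integrable_cst.
have dom k w : `|cval (cell k.+1 (X w))| <= `|X w| + 1.
  apply: le_trans (cval_cell_le _ _) _ => //; rewrite lerD2l invf_le1 // ler1n //.
have lim (F : R -> R) : (forall x, `|F x| <= `|x|) -> continuous F ->
    (fun k => Ex (celllaw k.+1) (fun v => F (cval v))) @ \oo -->
    fine (\int[P]_w (F (X w))%:E)%E.
  move=> FN cF.
  have mFX : measurable_fun setT (fun w => (F (X w))%:E).
    apply/measurable_EFinP; apply: measurableT_comp; last exact: measurable_funPT.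
    exact: continuous_measurable_fun.
  have cF' w : (fun k => (F (cval (cell k.+1 (X w))))%:E) @ \oo --> (F (X w))%:E.
    by apply: cvg_EFin; [exact: nearW|apply: continuous_cvg; [exact: cF|exact: cv]].
  have dF w k : (`|(F (cval (cell k.+1 (X w))))%:E| <= `|(X w)%:E| + 1%:E)%E.
    by rewrite -EFinD lee_fin (le_trans (FN _)).
  have [iF _ c1] := @dominated_convergence _ T R P setT measurableT
    (fun k w => (F (cval (cell k.+1 (X w))))%:E) (fun w => (F (X w))%:E)
    (fun w => `|(X w)%:E| + 1%:E)%E (fun k => mf k F) mFX
    (aeW _ (fun w _ => cF' w)) ig (aeW _ (fun w k _ => dF w k)).
  have : (fun k => (Ex (celllaw k.+1) (fun v => F (cval v)))%:E) @ \oo -->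
      (\int[P]_w (F (X w))%:E)%E.
    apply: cvg_trans c1; apply: near_eq_cvg; apply: nearW => k /=.
    by rewrite -(integral_law P (fun v => measurable_cell_RV v (ltn0Sn k)) (fun v => F (cval v))).
  by rewrite -[X in _ --> X -> _]fineK ?integrable_fin_num // => /fine_cvg.
have /cvgrPdist_le/(_ eps eps0) l1 := lim id (fun x => lexx _) (fun x => cvg_id).
have N2 (x : R) : `| `|x| | <= `|x| by rewrite normr_id.
have /cvgrPdist_le/(_ eps eps0) l2 := lim (fun x => `|x|) N2 (@norm_continuous _ _).
have E0 : fine (\int[P]_w (X w)%:E)%E = 0 by rewrite -expectation_def EX0.
have E1 : 1 / 10 <= fine (\int[P]_w (`|X w|)%:E)%E.
  rewrite -lee_fin fineK //; apply: integrable_fin_num => //.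
  exact: (integrable_abse iX).
near \oo => k.
exists k.+1; split=> //.
- by apply: leqW; near: k; exact: nbhs_infty_ge.
- rewrite -normrN -[X in `|X|]add0r -E0; near: k; exact: l1.
have : `|fine (\int[P]_w (`|X w|)%:E)%E -
    Ex (celllaw k.+1) (fun v => `|cval v|)| <= eps by near: k; exact: l2.
by rewrite ler_norml => /andP[_ h]; lra.
Unshelve. all: by end_near. Qed.

End Discretize.

(** * Transfer from the discretized matrix *)

Section Moments.
Context {R : realType}.

Lemma sum_expRN_le (J : nat) : \sum_(j < J) expR (- j%:R) <= 2 :> R.
Proof.
have e1 : expR (- 1) <= 1 / 2 :> R.
  rewrite expRN div1r lef_pV2 ?posrE ?expR_gt0 //.
  have := @expR_ge1Dx R 1; lra.
suff : \sum_(j < J) expR (- j%:R) <= 2 - 2 * expR (- J%:R) :> R.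
  by have := expR_gt0 (- J%:R : R); lra.
elim: J => [|J ih]; first by rewrite big_ord0 oppr0 expR0; lra.
rewrite big_ord_recr /= -[J.+1%:R]natr1 opprD expRD.
have := expR_gt0 (- J%:R : R); nra.
Qed.

(** Cut into unit layers: [e^(2 (j + 1))] against a tail [e^(- 3 j)] leaves a geometric series. *)
Lemma Ex_exp_of_tail (V : finType) (q c : V -> R) (D : R) : is_dist q ->
  (forall v, 0 <= c v) ->
  (forall j : nat, Pr q (fun v => j%:R <= c v) <= D * expR (- 3 * j%:R)) ->
  Ex q (fun v => expR (2 * c v)) <= 2 * D * expR 2.
Proof.
move=> q_dist c0 tail.
pose J := (\max_v Num.truncn (c v)).+1.
have D0 : 0 <= D.
  have := tail 0%N; rewrite mulr0 expR0 mulr1; apply: le_trans; exact: Pr_ge0.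
apply: (@le_trans _ _ (Ex q (fun v => \sum_(j < J) expR (2 * (j%:R + 1)) * (j%:R <= c v)%R%:R))).
  apply: le_Ex => // v.
  have hJ : (Num.truncn (c v) < J)%N.
    by rewrite ltnS; exact: (leq_bigmax (F := fun v => Num.truncn (c v))).
  have /andP[h1 h2] := truncn_itv (c0 v).
  rewrite (bigD1 (Ordinal hJ)) //= h1 mulr1 -[leLHS]addr0; apply: lerD.
    by rewrite ler_expR ler_pM2l // natr1 ltW.
  by apply: sumr_ge0 => j _; rewrite mulr_ge0 ?expR_ge0.
rewrite Ex_sum.
apply: (@le_trans _ _ (\sum_(j < J) D * expR 2 * expR (- j%:R))).
  apply: ler_sum => j _; rewrite ExZ.
  have -> : D * expR 2 * expR (- j%:R) = expR (2 * (j%:R + 1)) * (D * expR (- 3 * j%:R)).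
    rewrite [RHS]mulrCA -!mulrA -!expRD; congr (D * expR _); ring.
  by rewrite ler_wpM2l ?expR_ge0 //; exact: tail.
rewrite -mulr_sumr.
have := ler_wpM2l (mulr_ge0 D0 (expR_ge0 2)) (sum_expRN_le J); lra.
Qed.

Lemma sqr_exp_le (x : R) : 0 <= x -> x ^+ 2 * expR x <= 2 * expR (2 * x).
Proof.
move=> x0; have -> : 2 * x = x + x by ring.
rewrite expRD mulrA ler_wpM2r ?expR_ge0 //.
by have := expR_ge1Dxn 1 x0; rewrite (_ : (2`!)%N = 2%N) //; lra.
Qed.

End Moments.

(* Bounds [E rho^2 exp |rho|] for centered roundings: [15/2] comes from
   [(j - 1)^2 / 2 >= 3 j - 15/2]. *)
Definition moment_bound {R : realType} : R :=
  8 * expR (15 / 2) * expR 4.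

Lemma measurable_abs_ge d (T : measurableType d) (R : realType)
  (P : probability T R) (X : {RV P >-> R}) (c : R) : measurable [set w | c <= `|X w|].
Proof.
have mN : measurable_fun setT (fun w => `|X w|).
  by apply: measurableT_comp; [exact: continuous_measurable_fun (@norm_continuous _ _)|exact: measurable_funPT].
rewrite (_ : [set w | _] = setT `&` (fun w => `|X w|) @^-1` `[c, +oo[).
  by apply: mN => //; exact: measurable_itv.
by rewrite setTI; apply/seteqP; split => x /=; rewrite in_itv /= andbT.
Qed.

Section LawMoments.
Context d (T : measurableType d) (R : realType) (P : probability T R).
Variable X : {RV P >-> R}.
Hypothesis tailX : forall t : R, 0 < t ->
  (P [set w | (t <= `|X w|)%R] <= (2 * expR (- (t ^+ 2) / 2))%:E)%E.
Variable M : nat.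
Hypothesis M0 : (0 < M)%N.

Notation q := (law P (fun w => cell M (X w))).

Let mcell v := measurable_cell_RV X v M0 : measurable [set w | cell M (X w) = v].

Lemma cval_tail (j : nat) :
  Pr q (fun v => j%:R <= `|cval v| :> R) <= 2 * expR (15 / 2) * expR (- 3 * j%:R).
Proof.
rewrite -mulrA -expRD.
case: (leqP j 1) => [j1|j2].
  apply: (@le_trans _ _ 1); first by apply: Pr_le1; exact: law_dist.
  have : 1 <= expR (15 / 2 + - 3 * j%:R) :> R.
    have jR : j%:R <= 1 :> R by rewrite (ler_nat R j 1).
    rewrite -[leLHS]expR0 ler_expR; lra.
  lra.
have j1 : 0 < j%:R - 1 :> R by rewrite subr_gt0 ltr1n.
rewrite -lee_fin -(probability_law P mcell).
apply: (@le_trans _ _ (P [set w | (j%:R - 1 <= `|X w|)%R])).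
  apply: le_measure; rewrite ?inE; first exact: (measurable_law mcell (fun v => j%:R <= `|cval v| :> R)).
    exact: measurable_abs_ge.
  move=> w /= h; have := cval_cell_le M0 (X w).
  have : M%:R^-1 <= 1 :> R by rewrite invf_le1 ?ler1n ?ltr0n.
  by move: h; lra.
apply: le_trans (tailX j1) _; rewrite lee_fin ler_pM2l // ler_expR.
(* [(j - 1)^2 / 2 - 3 j + 15/2 = (j - 4)^2 / 2]. *)
have := sqr_ge0 (j%:R - 4 : R); rewrite !expr2; lra.
Qed.

Lemma Ex_centered_tail (m : R) : `|m| <= 1 ->
  Ex q (fun v => (cval v - m) ^+ 2 * expR `|cval v - m|) <= moment_bound.
Proof.
move=> m1.
have q_dist : is_dist q by exact: law_dist.
apply: (@le_trans _ _ (Ex q (fun v => 2 * expR 2 * expR (2 * `|cval v|)))).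
  apply: le_Ex => // v.
  rewrite -(real_normK (num_real (cval v - m))).
  apply: le_trans (sqr_exp_le (normr_ge0 _)) _.
  rewrite -mulrA -expRD ler_pM2l // ler_expR.
  have := ler_normB (cval v) m; move: m1; lra.
rewrite ExZ.
have h := Ex_exp_of_tail q_dist (fun v => normr_ge0 (cval v)) cval_tail.
have h2 := ler_wpM2l (mulr_ge0 (ler0n R 2) (expR_ge0 2)) h.
apply: le_trans h2 _; rewrite /moment_bound.
have -> : expR 4 = expR 2 * expR 2 :> R by rewrite -expRD; congr expR; ring.
by rewrite le_eqVlt; apply/orP; left; apply/eqP; ring.
Qed.

End LawMoments.

Section Perturbation.
Context {R : realType}.
Variables (V : finType) (rho : V -> R) (theta m e : R) (n p : nat).
Variable o : {ffun 'I_p -> {ffun 'I_n -> bool * V}}.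
Variable X : 'I_n -> 'I_p -> R.
Hypothesis X_close : forall l a, `|X l a - entry rho (o a l)| <= e.
Hypothesis X_zero : forall l a, ~~ (o a l).1 -> X l a = 0.
Hypotheses (p0 : (0 < p)%N) (e0 : 0 <= e) (e1 : e <= 1 / 400) (e2 : 4 * e < m)
  (e3 : 4 * e < 3 / 400 * theta).

Let chi l a := (o a l).1.

Let abs_close l a : `|X l a| <= `|entry rho (o a l)| + e /\
  `|entry rho (o a l)| <= `|X l a| + e.
Proof.
have h := X_close l a; have h1 := lerB_normD (X l a) (entry rho (o a l)).
have h2 := ler_dist_dist (X l a) (entry rho (o a l)).
by move: (le_trans h2 h); rewrite ler_norml => /andP[]; split; lra.
Qed.

Let sum_close (f g : 'I_p -> R) (c : R) : (forall a, f a <= g a + c) ->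
  \sum_a f a <= \sum_a g a + p%:R * c.
Proof.
move=> fg; apply: le_trans (ler_sum _ (fun a _ => fg a)) _.
by rewrite big_split /= sumr_const card_ord mulr_natl.
Qed.

(** Supports are not rounded, so [hits] and [touches] agree. For (a), [|b l| <= |b k| / 2 + 3 e] and
    [|b k| >= 1/20 - 2 e], which gives [2/3] exactly when [e <= 1/400]; in (c) the three sums move
    by at most [(2 + 1 + 2/3) p e < 4 p e]. *)
Lemma recovery_of_good_pair k i j : good_pair rho theta m o k i j ->
  [/\ (i < j)%N, X k i + X k j != 0,
     (forall z, \sum_l (X l i + X l j) * z l = 1 ->
        abs_row X k / `|X k i + X k j| <= l1image X z) &
     (forall z, \sum_l (X l i + X l j) * z l = 1 ->
        l1image X z <= abs_row X k / `|X k i + X k j| ->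
        forall l, l != k -> z l = 0)].
Proof.
move=> [ij kJ [bk bgap] hsigned hsingle].
set J := pair_supp o i j in kJ hsigned hsingle.
have pp : 0 < p%:R :> R by rewrite ltr0n.
pose b l := X l i + X l j.
have bclose l : `|b l - pair_sum rho o i j l| <= 2 * e.
  have -> : b l - pair_sum rho o i j l = (X l i - entry rho (o i l)) + (X l j - entry rho (o j l)).
    by rewrite /b /pair_sum; ring.
  by apply: le_trans (ler_normD _ _) _; have := X_close l i; have := X_close l j; lra.
have bclose1 l : `|b l| <= `|pair_sum rho o i j l| + 2 * e.
  have := le_trans (ler_dist_dist (b l) (pair_sum rho o i j l)) (bclose l).
  by rewrite ler_norml => /andP[_]; lra.
have bclose2 l : `|pair_sum rho o i j l| <= `|b l| + 2 * e.
  have := le_trans (ler_dist_dist (b l) (pair_sum rho o i j l)) (bclose l).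
  by rewrite ler_norml => /andP[+ _]; lra.
have bk0 : b k != 0.
  by rewrite -normr_gt0; have := bclose2 k; move: bk e1; lra.
have b_gap l : l != k -> `|b l| <= 2 / 3 * `|b k|.
  move=> lk; have := bgap l lk; have := bclose1 l; have := bclose2 k.
  by move: bk e1; lra.
have b_J l : l \notin J -> b l = 0.
  by rewrite !inE negb_or => /andP[li lj]; rewrite /b !X_zero // addr0.
have off v : (forall l, l \in J -> v l = 0) -> \sum_l `|v l| = 1 ->
    0 < signed_image X chi J v.
  move=> vJ v1; have := hsigned v vJ v1.
  suff : signed_sum rho o J v <= signed_image X chi J v + p%:R * e.
    by have := ltr_pM2l pp (4 * e) m; rewrite e2 => /esym h; move: h; lra.
  apply: sum_close => a.
  have h : `| `|\sum_l v l * X l a| - `|\sum_l v l * entry rho (o a l)| | <= e.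
    apply: le_trans (ler_dist_dist _ _) _; rewrite -sumrB.
    apply: le_trans (ler_norm_sum _ _ _) _.
    apply: (@le_trans _ _ (\sum_l `|v l| * e)); last by rewrite -mulr_suml v1 mul1r.
    by apply: ler_sum => l _; rewrite -mulrBr normrM ler_wpM2l.
  rewrite (_ : hits J (o a) = touches chi J a) //.
  by move: h; rewrite ler_norml => /andP[]; case: touches; lra.
have on l : l \in J -> l != k ->
    2 / 3 * abs_row X k < 2 * lone_row X chi J l - abs_row X l.
  move=> lJ lk; have := hsingle l lJ lk.
  have row l' : abs_row X l' <= row_sum rho o l' + p%:R * e.
    by apply: sum_close => a; have [] := abs_close l' a.
  have lone : single_sum rho o J l <= lone_row X chi J l + p%:R * e.
    apply: sum_close => a; have [_ h] := abs_close l a.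
    rewrite (_ : hits (J :\ l) (o a) = touches chi (J :\ l) a) //.
    by case: touches; rewrite /= ?mulr0 ?mulr1 ?add0r.
  have := row l; have := row k; move: lone.
  have : p%:R * (4 * e) < p%:R * (3 / 400 * theta) by rewrite ltr_pM2l.
  have := mulr_ge0 (ltW pp) e0; lra.
split=> //.
- exact: (l1image_lower X_zero kJ b_J bk0 b_gap off on).
- exact: (l1image_min X_zero kJ b_J bk0 b_gap off on).
Qed.

End Perturbation.

(** * Law of the discretized matrix *)

Section JointLaw.
Context d (T : measurableType d) (R : realType) (P : probability T R).
Variables (n p : nat) (theta : R) (chi Rv : 'I_n -> 'I_p -> {RV P >-> R}).
Hypothesis model : BS_model theta chi Rv.
Variable M : nat.
Hypothesis M0 : (0 < M)%N.
(** A reference entry: all [R_ij] having the same law, its cell law serves for all of them. *)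
Variables (l0 : 'I_n) (a0 : 'I_p).

Notation V := ('I_(2 * M * M).+1).
Notation q := (law P (fun w => cell M (Rv l0 a0 w))).

(** Any value of [chi] other than 1 is encoded as inactive; values outside [{0, 1}] form a null set,
    which is removed in [exists_recovery_event]. *)
Definition discretized (w : T) : {ffun 'I_p -> {ffun 'I_n -> bool * V}} :=
  [ffun a => [ffun l => (chi l a w == 1, cell M (Rv l a w))]].

Let box (c : bool * V) (b : bool) : set R :=
  if b then (if c.1 then [set 1] else ~` [set 1]) else [set x | cell M x = c.2].

Let measurable_box c b : measurable (box c b).
Proof.
case: b => /=; last exact: measurable_cell.
by case: c.1; [|apply: measurableC]; exact: measurable_set1.
Qed.

Let var (s : ('I_n * 'I_p) + ('I_n * 'I_p)) : {RV P >-> R} :=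
  match s with inl (i, j) => chi i j | inr (i, j) => Rv i j end.

Let cyl (o : {ffun 'I_p -> {ffun 'I_n -> bool * V}}) (s : ('I_n * 'I_p) + ('I_n * 'I_p)) :
  set R := match s with inl (i, j) => box (o j i) true | inr (i, j) => box (o j i) false end.

Let measurable_cyl o s : measurable (cyl o s).
Proof. by case: s => -[i j]; exact: measurable_box. Qed.

Let discretizedE o : [set w | discretized w = o] =
  \bigcap_(s in [set: ('I_n * 'I_p) + ('I_n * 'I_p)]) (var s @^-1` cyl o s).
Proof.
apply/seteqP; split=> [w /= <-|w h].
  move=> [[i j]|[i j]] _ /=; rewrite !ffunE /box //=.
  by case: eqP.
apply/ffunP => a; apply/ffunP => l; rewrite !ffunE.
have h1 := h (inl (l, a)) I; have h2 := h (inr (l, a)) I.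
move: h1 h2; rewrite /= /box; case: (o a l) => -[] c /=.
  by move=> -> ->; rewrite eqxx.
by move=> h1 ->; congr pair; apply/eqP.
Qed.

Lemma measurable_discretized o : measurable [set w | discretized w = o].
Proof.
rewrite discretizedE; apply: fin_bigcap_measurable => // s _.
by apply: measurable_funPTI; exact: measurable_cyl.
Qed.

Lemma law_discretized : law P discretized =1 prodw (prodw (entryw q theta)).
Proof.
move=> o; have [_ indep Pchi ident _] := model.
have mq v := measurable_cell_RV (Rv l0 a0) v M0.
have Pcell l a v : P (Rv l a @^-1` [set x | cell M x = v]) = (q v)%:E.
  rewrite (ident l a l0 a0); last exact: measurable_cell.
  exact: (law_fin P mq).
have Pflip l a (c : bool) : P (chi l a @^-1` (if c then [set 1] else ~` [set 1])) =
   (if c then theta else 1 - theta)%:E.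
  have [h1 _] := Pchi l a.
  case: c; first exact: h1.
  rewrite /= -preimage_setC probability_setC; last first.
    by apply: measurable_funPTI; exact: measurable_set1.
  by rewrite [X in (1 - X)%E](_ : _ = theta%:E) //; exact: h1.
rewrite /law discretizedE (indep _ (measurable_cyl o)) big_sumType /=.
rewrite (eq_bigr (fun s : 'I_n * 'I_p => (if (o s.2 s.1).1 then theta else 1 - theta)%:E)); last first.
  by move=> [i j] _ /=; rewrite /box Pflip.
rewrite [X in (_ * X)%E](eq_bigr (fun s : 'I_n * 'I_p => (q (o s.2 s.1).2)%:E)); last first.
  by move=> [i j] _ /=; rewrite /box Pcell.
rewrite !prodEFin /= -big_split /=.
rewrite (eq_bigr (fun s : 'I_n * 'I_p => entryw q theta (o s.2 s.1))) //.
rewrite -(pair_bigA _ (fun i j => entryw q theta (o j i))) /= exchange_big.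
by [].
Qed.

End JointLaw.

(** * Constants and conclusion *)

Section Constants.
Context {R : realType}.

Lemma expR1_le4 : expR 1 <= 4 :> R.
Proof.
have h : 1 / 2 <= expR (- (1 / 2)) :> R by have := @expR_ge1Dx R (- (1 / 2)); lra.
have -> : expR 1 = (expR (- (1 / 2)))^-1 ^+ 2 :> R.
  by rewrite expRN invrK expr2 -expRD; congr expR; lra.
have -> : 4 = (1 / 2)^-1 ^+ 2 :> R by rewrite div1r invrK; lra.
by rewrite lerXn2r ?nnegrE ?invr_ge0 ?expR_ge0 // lef_pV2 ?posrE ?expR_gt0.
Qed.

(** Trades [log n] for [log p]. If [p <= n^2], then [ln p <= 2 ln n] and the term [2 D] suffices.
    Otherwise put [y = p^(1/4)]: [ln p <= 4 y], [n <= y^2], and [256 D^4 = (4 D)^4] gives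
    [4 D <= y]. The term [1] gives [n <= p]. *)
Lemma ln_sample_size (n p : nat) (D : R) : 0 < D -> (4 <= n)%N ->
  (256 * D ^+ 4 + 2 * D + 1) * n%:R * ln n%:R <= p%:R ->
  (n <= p)%N /\ D * n%:R * ln p%:R <= p%:R.
Proof.
move=> D0 n4; set C := 256 * D ^+ 4 + 2 * D + 1 => hp.
have n1 : 4 <= n%:R :> R by rewrite (ler_nat R 4 n).
have ln1 : 1 <= ln n%:R :> R.
  rewrite -[leLHS]expRK ler_ln ?posrE ?expR_gt0 //; last by lra.
  by apply: le_trans n1; exact: expR1_le4.
have D4 : 0 <= 256 * D ^+ 4 by apply: mulr_ge0; [rewrite ler0n|rewrite exprn_ge0 // ltW].
have nl : n%:R <= n%:R * ln n%:R :> R by rewrite ler_peMr.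
have Cnl : C * n%:R * ln n%:R = 256 * D ^+ 4 * (n%:R * ln n%:R) +
    2 * D * (n%:R * ln n%:R) + n%:R * ln n%:R by rewrite /C; ring.
have t1 : 0 <= 256 * D ^+ 4 * (n%:R * ln n%:R) by rewrite mulr_ge0 //; lra.
have t2 : 0 <= 2 * D * (n%:R * ln n%:R) by rewrite mulr_ge0 //; lra.
have np : n%:R <= p%:R :> R by rewrite Cnl in hp; lra.
split; first by rewrite -(ler_nat R).
have p0 : 0 < p%:R :> R by lra.
case: (lerP p%:R (n%:R ^+ 2 : R)) => hpn.
  have : ln p%:R <= 2 * ln n%:R :> R.
    rewrite mulr_natl -lnXn ?ler_ln ?posrE ?exprn_gt0 //; lra.
  move=> h; have := ler_wpM2l (_ : 0 <= D * n%:R) h.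
  rewrite mulr_ge0 ?(ltW D0) // => /(_ isT).
  rewrite Cnl in hp; lra.
pose y : R := Num.sqrt (Num.sqrt p%:R).
have y4 : y ^+ 4 = p%:R by rewrite (exprM y 2 2) !sqr_sqrtr ?sqrtr_ge0 // ltW.
have y0 : 0 < y by rewrite !sqrtr_gt0.
have lnp : ln p%:R <= 4 * y.
  rewrite -y4 lnXn // mulr_natl ler_wMn2r // ltW //.
  exact: ln_sublinear.
have ny : n%:R <= y ^+ 2.
  rewrite -(ler_pXn2r (n := 2)) ?nnegrE ?exprn_ge0 ?(ltW y0) //.
  by rewrite -exprM y4 ltW.
have Dy : 4 * D <= y.
  rewrite -(ler_pXn2r (n := 4)) ?nnegrE ?(ltW y0) //; last by lra.
  rewrite y4; apply: le_trans hp; rewrite Cnl.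
  have -> : (4 * D) ^+ 4 = 256 * D ^+ 4 by ring.
  have : 256 * D ^+ 4 <= 256 * D ^+ 4 * (n%:R * ln n%:R) by rewrite ler_peMr //; lra.
  lra.
have h1 : D * n%:R * ln p%:R <= D * y ^+ 2 * (4 * y).
  apply: le_trans (ler_wpM2l _ lnp) _; first by rewrite mulr_ge0 // ltW.
  by rewrite ler_wpM2r ?ler_wpM2l ?(ltW D0) //; lra.
apply: le_trans h1 _.
have -> : D * y ^+ 2 * (4 * y) = 4 * D * y ^+ 3 by ring.
by rewrite -y4 [y ^+ 4]exprS ler_wpM2r // exprn_ge0 // ltW.
Qed.

(* The rate at which all failure probabilities decay: each of them is at most
   a polynomial in [p] times [expR (- (rate K * p / n))]. *)
Definition rate (K : R) : R := K^-1 ^+ 3 / 128 / 4 / 6400 / 6400 / 160 / 160.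

Lemma rate_gt0 K : 1 <= K -> 0 < rate K.
Proof.
move=> K1; have : 0 < K^-1 ^+ 3 by rewrite exprn_gt0 // invr_gt0; lra.
by rewrite /rate; lra.
Qed.

Lemma rate_le K : 1 <= K ->
  rate K <= 2 * (K^-1 / 1600 / 1600) /\ rate K <= K^-1 / 6400 / 16.
Proof.
move=> K1.
have i0 : 0 <= K^-1 by rewrite invr_ge0; lra.
have i1 : K^-1 <= 1 by rewrite invf_le1 //; lra.
have i3 : K^-1 ^+ 3 <= K^-1 by rewrite exprS ler_piMr // exprn_ile1.
have : 0 <= K^-1 ^+ 3 by rewrite exprn_ge0.
by rewrite /rate; split; lra.
Qed.

(** The second bound is an equality before comparison with [x]: [rate] collects its constants. In
    the third [theta] cancels, and in the first it is absorbed by [2 <= n theta]. *)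
Lemma rate_bounds (K theta : R) (n : nat) (x y : R) : 1 <= K -> 0 < theta -> 0 <= y ->
  (0 < n)%N -> 2 <= n%:R * theta -> x <= rate K * (y / n%:R) ->
  let m := theta / 6400 / (160 * K * Num.sqrt (n%:R * theta)) / 2 in
  [/\ x <= y * theta / K / 1600 / 1600,
      x <= y * m ^+ 2 / (128 * theta * K) &
      x <= y / 4 * (theta * (1 / (6400 * K) / (n%:R * theta)) / 4)].
Proof.
move=> K1 t0 y0 n0 nt hx m.
have [r1 r2] := rate_le K1.
have yn0 : 0 <= y / n%:R by rewrite divr_ge0.
have i0 : 0 <= K^-1 by rewrite invr_ge0 (le_trans ler01).
have yE : y = y / n%:R * n%:R by rewrite divfK // pnatr_eq0 -lt0n.
have tt : theta * theta^-1 = 1 by rewrite mulfV // gt_eqF.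
split; apply: (le_trans hx).
- have -> : y * theta / K / 1600 / 1600 = K^-1 / 1600 / 1600 * (y / n%:R) * (n%:R * theta).
    rewrite {1}yE; move: (y / n%:R) (K^-1) (1600^-1 : R) => u v w; ring.
  apply: le_trans (ler_wpM2r yn0 r1) _.
  have : 0 <= K^-1 / 1600 / 1600 by rewrite !divr_ge0 ?ler0n.
  move: (K^-1 / 1600 / 1600) => g g0.
  have -> : 2 * g * (y / n%:R) = g * (y / n%:R) * 2 by ring.
  by rewrite ler_wpM2l // mulr_ge0.
- rewrite le_eqVlt; apply/orP; left; apply/eqP; apply: esym; rewrite /m /rate.
  have rr : (Num.sqrt (n%:R * theta))^-1 ^+ 2 = n%:R^-1 * theta^-1.
    by rewrite exprVn sqr_sqrtr ?invfM // (le_trans _ nt).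
  rewrite !invfM.
  move: rr tt; move: (Num.sqrt _)^-1 (6400^-1 : R) (160^-1 : R) (K^-1) (theta^-1) (n%:R^-1) (128^-1 : R) => r a b i u v c rr tt.
  transitivity (y * c * (a ^+ 2 * b ^+ 2 * i ^+ 3 / 4) * (theta ^+ 2 * u * r ^+ 2)).
    by field.
  rewrite rr; transitivity (y * c * (a ^+ 2 * b ^+ 2 * i ^+ 3 / 4) * v * (theta * u) ^+ 2).
    by ring.
  rewrite tt; by ring.
- have -> : y / 4 * (theta * (1 / (6400 * K) / (n%:R * theta)) / 4) =
     K^-1 / 6400 / 16 * (y / n%:R) * (theta * theta^-1).
    rewrite !invfM; move: (6400^-1 : R) (K^-1) (theta^-1) (n%:R^-1) => a i u v.
    have -> : (16 : R) = 4 * 4 by ring.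
    by rewrite invfM; move: (4^-1 : R) => c; ring.
  by rewrite tt mulr1 ler_wpM2r.
Qed.

End Constants.

Section Main.
Context {R : realType}.

(** The prefactor is at most [6 p^3], so a decay of [p^-6] leaves [6 p^-3 <= 1 / (2 p)]. *)
Lemma polynomial_tail (n p : nat) : (n <= p)%N -> (4 <= p)%N ->
  3 * n%:R * (1 + p%:R ^+ 2) * expR (- (6 * ln p%:R)) <= 1 / 2 * p%:R^-1 :> R.
Proof.
move=> np p4; have pR : 4 <= p%:R :> R by rewrite (ler_nat R 4 p).
have nR : n%:R <= p%:R :> R by rewrite ler_nat.
have p0 : 0 < p%:R :> R by lra.
have -> : expR (- (6 * ln p%:R)) = (p%:R ^+ 6)^-1 :> R.
  by rewrite expRN expRM_natl lnK ?posrE.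
rewrite ler_pdivrMr ?exprn_gt0 //.
have -> : 1 / 2 * p%:R^-1 * p%:R ^+ 6 = 1 / 2 * p%:R ^+ 5 :> R.
  by rewrite exprS mulrA mulfVK // gt_eqF.
move: (p%:R : R) (n%:R : R) pR nR p0 (ler0n R n) => x y x4 yx x0 y0.
have x2 : 16 <= x ^+ 2 by rewrite expr2; nra.
have h1 : 3 * y * (1 + x ^+ 2) <= 3 * x * (2 * x ^+ 2).
  by apply: ler_pM; lra.
apply: (le_trans h1).
have -> : 1 / 2 * x ^+ 5 = x * x ^+ 2 * (x ^+ 2 / 2) by field.
have x3 : 0 <= x * x ^+ 2 by rewrite mulr_ge0 //; lra.
have -> : 3 * x * (2 * x ^+ 2) = x * x ^+ 2 * 6 by ring.
by rewrite ler_wpM2l //; lra.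
Qed.

Lemma gaussian_tail_small (n p M : nat) : (0 < n)%N -> (0 < p)%N ->
  (8 * n * p * p <= M)%N ->
  (n * p)%:R * (2 * expR (- (M%:R ^+ 2) / 2)) <= 1 / 2 * p%:R^-1 :> R.
Proof.
move=> n0 p0 hM.
have np0 : (0 < n * p)%N by rewrite muln_gt0 n0.
have M1 : 1 <= M%:R :> R.
  by rewrite ler1n; apply: leq_trans hM; rewrite !muln_gt0 n0 p0.
have hMR : 8 * (n * p)%:R * p%:R <= M%:R :> R.
  by rewrite -!natrM ler_nat mulnA.
have pR : 0 < p%:R :> R by rewrite ltr0n.
have npR : 0 < (n * p)%:R :> R by rewrite ltr0n.
have e1 : expR (- (M%:R ^+ 2) / 2) <= 2 / M%:R :> R.
  have -> : - (M%:R ^+ 2) / 2 = - (M%:R ^+ 2 / 2) :> R by rewrite mulNr.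
  rewrite expRN -[leRHS]invrK lef_pV2 ?posrE ?expR_gt0 ?invr_gt0 ?divr_gt0 //; last by lra.
  rewrite invf_div; apply: le_trans (expR_ge1Dx _).
  have : M%:R <= M%:R ^+ 2 :> R by rewrite expr2 ler_peMl //; lra.
  lra.
apply: (@le_trans _ _ ((n * p)%:R * (2 * (2 / M%:R)))).
  by rewrite ler_wpM2l ?(ltW npR) // ler_wpM2l.
have M0 : 0 < M%:R :> R by lra.
rewrite -(ler_pM2r M0) -(ler_pM2r pR).
have -> : (n * p)%:R * (2 * (2 / M%:R)) * M%:R * p%:R = 4 * (n * p)%:R * p%:R :> R.
  by field; lra.
have -> : 1 / 2 * p%:R^-1 * M%:R * p%:R = M%:R / 2 :> R by field; lra.
lra.
Qed.

Lemma Pr_cell_max d (T : measurableType d) (P : probability T R)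
  (X : {RV P >-> R}) (M : nat) : (0 < M)%N ->
  (forall t : R, 0 < t ->
    (P [set w | (t <= `|X w|)%R] <= (2 * expR (- (t ^+ 2) / 2))%:E)%E) ->
  Pr (law P (fun w => cell M (X w))) (fun v => ~~ (v < 2 * M * M)%N) <=
  2 * expR (- (M%:R ^+ 2) / 2).
Proof.
move=> M0 tailX; have M0R : 0 < M%:R :> R by rewrite ltr0n.
have mcell v := measurable_cell_RV X v M0.
rewrite -lee_fin -(probability_law P mcell (fun v => ~~ (v < 2 * M * M)%N)).
apply: le_trans (tailX _ M0R).
apply: le_measure; rewrite ?inE; [exact: (measurable_law mcell (fun v => ~~ (v < 2 * M * M)%N))|exact: measurable_abs_ge|].
move=> w /=; rewrite cell_lt // => h; rewrite leNgt; apply/negP => hw.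
by case/negP: h; move: hw; rewrite ltr_norml => /andP[/ltW -> ->].
Qed.

Lemma moment_bound_ge1 : 1 <= moment_bound :> R.
Proof.
rewrite /moment_bound.
have e1 : 1 <= expR (15 / 2) :> R by rewrite -[leLHS]expR0 ler_expR; lra.
have e2 : 1 <= expR 4 :> R by rewrite -[leLHS]expR0 ler_expR; lra.
have := mulr_ege1 e1 e2; lra.
Qed.

End Main.

(** The level [eta], with [a = n theta]: small enough for the quantile to exceed [1/40] and for the
    other entries of a column to stay below it, yet [theta * eta] is of order [1 / n]. *)
Lemma quantile_level (R : realType) (K a : R) : 1 <= K -> 1 <= a ->
  [/\ 0 < 1 / (6400 * K) / a, 1 / (6400 * K) / a <= 1 / (6400 * K) &
      a * (1 / (6400 * K) / a) <= 1 / 8].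
Proof.
move=> K1 a1; have a0 : 0 < a by exact: lt_le_trans ltr01 a1.
have [D D8 ->] : exists2 D : R, 8 <= D & 6400 * K = D by exists (6400 * K); lra.
have D0 : 0 < D by lra.
have iD : 0 < 1 / D by rewrite divr_gt0.
split; first exact: divr_gt0.
- by rewrite ler_pdivrMr // ler_peMr // ltW.
- by rewrite mulrC divfK ?gt_eqF // !mul1r lef_pV2 ?posrE.
Qed.

(** * The event of recovery *)

Section RecoveryEvent.
Context d (T : measurableType d) (R : realType) (P : probability T R).
Variables (n p : nat) (theta : R) (chi Rv : 'I_n -> 'I_p -> {RV P >-> R}).
Hypothesis model : BS_model theta chi Rv.
Hypotheses (n0 : (0 < n)%N) (p160 : (160 <= p)%N) (np : (n <= p)%N).
Hypothesis n_theta : 2 <= n%:R * theta.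
Hypothesis n_theta2 : n%:R * theta ^+ 2 <= 1 / 1280.

Notation K := (@moment_bound R).

Hypothesis sample : 6 * ln p%:R <= rate K * (p%:R / n%:R).

Let m : R := theta / 6400 / (160 * K * Num.sqrt (n%:R * theta)) / 2.

Let m_gt0 : 0 < m.
Proof.
have [/andP[t0 _] _ _ _ _] := model.
have K0 : 0 < K by apply: lt_le_trans ltr01 (@moment_bound_ge1 R).
have s0 : 0 < Num.sqrt (n%:R * theta) by rewrite sqrtr_gt0; move: n_theta; lra.
rewrite /m; apply: divr_gt0; last by rewrite ltr0n.
apply: divr_gt0; first by apply: divr_gt0; rewrite ?ltr0n.
by apply: mulr_gt0 s0; apply: mulr_gt0 K0; rewrite ltr0n.
Qed.

(** [ok] marks the cells of bounded range. The cell values are recentered because the finite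
    estimates need mean exactly zero; the shift is at most [eps], whence the total error [2 eps]. *)
Lemma exists_discretization (eps : R) : 0 < eps -> eps <= 1 / 40 ->
  exists (V : finType) (q rho : V -> R) (ok : pred V) (cl : R -> V),
  [/\ is_dist q, Ex q rho = 0, 1 / 20 <= Ex q (fun v => `|rho v|),
      Ex q (fun v => rho v ^+ 2 * expR `|rho v|) <= K & 
  [/\ (n * p)%:R * Pr q (fun v => ~~ ok v) <= 1 / 2 * p%:R^-1,
      (forall x, ok (cl x) -> `|x - rho (cl x)| <= 2 * eps) ,
      (forall o, measurable [set w | [ffun a => [ffun l => (chi l a w == 1, cl (Rv l a w))]] = o]) &
      law P (fun w => [ffun a => [ffun l => (chi l a w == 1, cl (Rv l a w))]] :
         {ffun 'I_p -> {ffun 'I_n -> bool * V}}) =1 prodw (prodw (entryw q theta)) ]].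
Proof.
move=> eps0 eps40.
have [_ _ _ _ momR] := model.
have p0 : (0 < p)%N by apply: leq_trans p160.
pose l0 := Ordinal n0; pose a0 := Ordinal p0.
have [ER absR tailR] := momR l0 a0.
(* [8 n p^2] makes leaving the range unlikely, and [1 / eps] makes the mesh at most [eps]. *)
have [M [hM M0 h1 h2]] := discretize (8 * n * p * p + (Num.truncn eps^-1).+1) eps0 ER absR.
pose q := law P (fun w => cell M (Rv l0 a0 w)).
have q_dist : is_dist q.
  by apply: law_dist => v; exact: measurable_cell_RV.
pose mm := Ex q (fun v => cval v).
have iM : M%:R^-1 <= eps.
  rewrite invf_ple ?posrE ?ltr0n //; apply: le_trans (ltW (truncnS_gt _)) _.
  by rewrite ler_nat; apply: leq_trans hM; exact: leq_addl.
exists 'I_(2 * M * M).+1, q, (fun v => cval v - mm),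
  (fun v : 'I_(2 * M * M).+1 => (v < 2 * M * M)%N), (cell M).
split=> //.
- by rewrite ExB Ex_cst // subrr.
- have : Ex q (fun v => `|cval v|) <= Ex q (fun v => `|cval v - mm| + eps).
    apply: le_Ex => // v; rewrite -[X in `|X| <= _](subrK mm).
    by apply: le_trans (ler_normD _ _) _; rewrite lerD2l.
  rewrite ExD Ex_cst //; move: h2; rewrite -/q; lra.
- by apply: Ex_centered_tail => //; apply: le_trans h1 _; lra.
split.
- apply: le_trans (gaussian_tail_small n0 p0 (leq_trans (leq_addr _ _) hM)).
  by rewrite ler_wpM2l //; exact: Pr_cell_max.
- move=> x; rewrite cell_lt // => /(cval_close M0); rewrite distrC => hx.
  have -> : x - (cval (cell M x) - mm) = (x - cval (cell M x)) + mm by ring.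
  by apply: le_trans (ler_normD _ _) _; move: hx h1 iM; rewrite -/q -/mm; lra.
- exact: measurable_discretized.
- exact: law_discretized.
Qed.

Lemma exists_recovery_event (A : 'M[R]_n) : A \in unitmx ->
  exists E : set T, [/\ measurable E,
      E `<=` [set w | erspud_recovers (A *m BS_matrix chi Rv w) (BS_matrix chi Rv w)] &
      ((1 - p%:R^-1)%:E <= P E)%E].
Proof.
move=> A_unit.
have [theta01 _ Pchi _ _] := model; have /andP[t0 _] := theta01.
have p0 : (0 < p)%N by apply: leq_trans p160.
(* The entrywise error is [e = 2 eps]; the three terms secure [e <= 1/400], [4 e < m] and
   [4 e < 3/400 * theta]. *)
pose eps : R := Num.min (1 / 800) (Num.min (m / 16) (theta / 2000)).
have eps0 : 0 < eps.
  rewrite /eps !lt_min; have h := m_gt0; apply/and3P; split; [lra|lra|].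
  by apply: divr_gt0; [exact: t0|rewrite ltr0n].
have [eps1 [eps2 eps3]] : eps <= 1 / 800 /\ eps <= m / 16 /\ eps <= theta / 2000.
  by rewrite /eps !ge_min !lexx !orbT.
have eps40 : eps <= 1 / 40 by lra.
have [V [q [rho [ok [cl [q_dist rho0 rho1 rho2 [tail close mg lawE]]]]]]] :=
  exists_discretization eps0 eps40.
set g := (fun w => [ffun a => [ffun l => (chi l a w == 1, cl (Rv l a w))]]) in mg lawE.
pose good (o : {ffun 'I_p -> {ffun 'I_n -> bool * V}}) : bool :=
  `[< forall k, exists i j, good_pair rho theta m o k i j >].
(* No good pair for some row, or an entry out of the range of the cells; each has probability at
   most [1 / (2 p)]. *)
pose bad o := ~~ good o || [exists a, [exists l, ~~ ok (o a l).2]].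
have E_dist : is_dist (entryw q theta) by exact: entryw_dist.
have C_dist : is_dist (prodw (entryw q theta) : {ffun 'I_n -> bool * V} -> R).
  exact: prodw_dist.
have M_dist : is_dist (prodw (prodw (entryw q theta)) :
    {ffun 'I_p -> {ffun 'I_n -> bool * V}} -> R) by exact: prodw_dist.
have Pbad : Pr (law P g) bad <= p%:R^-1.
  have -> : Pr (law P g) bad = Pr (prodw (prodw (entryw q theta))) bad.
    by apply: eq_bigr => o _; rewrite lawE.
  apply: le_trans (Pr_or M_dist _ _) _.
  have -> : p%:R^-1 = 1 / 2 * p%:R^-1 + 1 / 2 * p%:R^-1 :> R by lra.
  apply: lerD.
    have [x1 x2 x3] := rate_bounds (@moment_bound_ge1 R) t0 (ler0n R p) n0 n_theta sample.
    have nt1 : 1 <= n%:R * theta by apply: le_trans n_theta; rewrite ler1n.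
    have K1 := @moment_bound_ge1 R.
    have [eta0 eta1 eta2] := quantile_level K1 nt1.
    apply: le_trans (Pr_good_pairs q_dist theta01 K1 rho0 rho1 rho2 nt1 n_theta2 p160
      (erefl m) (ltW m_gt0) eta0 eta1 eta2 x1 x2 x3) _.
    by apply: polynomial_tail => //; apply: leq_trans p160.
  apply: le_trans tail; apply: le_trans (Pr_exists M_dist _) _.
  set X := Pr q _; have -> : (n * p)%:R * X = \sum_(a < p) \sum_(l < n) X.
    by rewrite !sumr_const !card_ord -mulrnA mulr_natl.
  apply: ler_sum => a _.
  rewrite (Pr_coord C_dist a (fun c : {ffun 'I_n -> bool * V} => [exists l, ~~ ok (c l).2])).
  apply: le_trans (Pr_exists C_dist _) _.
  apply: ler_sum => l _.
  rewrite (Pr_coord E_dist l (fun u : bool * V => ~~ ok u.2)) /Pr Ex_entryw /=.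
  by rewrite -mulrDl addrC subrK mul1r.
(* Off this null set [chi] takes only the values 0 and 1, so an entry encoded as inactive is really
   zero. *)
have [N [mN PN0 subN]] : {ae P, forall w, forall s : 'I_n * 'I_p,
    chi s.1 s.2 w = 1 \/ chi s.1 s.2 w = 0}.
  apply: filter_forall => -[l a] /=.
  have [c1 c0] := Pchi l a.
  have m1 : measurable (chi l a @^-1` [set 1]) by apply: measurable_funPTI; exact: measurable_set1.
  have m0 : measurable (chi l a @^-1` [set 0]) by apply: measurable_funPTI; exact: measurable_set1.
  exists (~` (chi l a @^-1` [set 1] `|` chi l a @^-1` [set 0])); split.
  - by apply: measurableC; exact: measurableU.
  - rewrite probability_setC; last exact: measurableU.
    rewrite measureU //; last first.
      apply/seteqP; split=> w //= [-> /eqP]; rewrite oner_eq0 //.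
    have c10 : (P [set w | chi l a w = 1%R] + P [set w | chi l a w = 0%R] = 1)%E.
      by rewrite c1 c0 -EFinD; congr EFin; ring.
    by rewrite [X in (1 - X)%E](_ : _ = 1%E); [rewrite subee|exact: c10].
  - by move=> w /= hw hw'; apply: hw; case: hw' => ->; [left|right].
have mS := measurable_law mg (fun o => ~~ bad o).
exists ([set w | ~~ bad (g w)] `\` N); split.
- exact: measurableD.
- move=> w [/= gw Nw]; have chi01 s : chi s.1 s.2 w = 1 \/ chi s.1 s.2 w = 0.
    by move: s; apply: contrapT => hs; apply: Nw; apply: subN.
  move: gw; rewrite negb_or negbK => /andP[/asboolP gw okw].
  apply: erspud_recovers_of_unique => // k.
  have [i [j gp]] := gw k; exists i, j.
  apply: (@recovery_of_good_pair R V rho theta m (2 * eps) n p (g w)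
    (BS_matrix chi Rv w) _ _ _ _ _ _ _ k i j gp) => //.
  + move=> l a; rewrite mxE /entry !ffunE /=.
    have okla : ok (cl (Rv l a w)).
      move: okw; rewrite negb_exists => /forallP/(_ a); rewrite negb_exists => /forallP/(_ l).
      by rewrite negbK !ffunE.
    case: (chi01 (l, a)) => /= ->.
      by rewrite eqxx mul1r; exact: close.
    by rewrite mul0r eq_sym oner_eq0 subrr normr0 mulr_ge0 // ltW.
  + move=> l a; rewrite mxE !ffunE /=; case: (chi01 (l, a)) => /= ->; first by rewrite eqxx.
    by rewrite mul0r.
  + by rewrite mulr_ge0 // ltW.
  + by lra.
  + by have := m_gt0; lra.
  + by lra.
have h1 : P [set w | ~~ bad (g w)] = (1 - Pr (law P g) bad)%:E.
  by rewrite (probability_law P mg (fun o => ~~ bad o)) PrC //; exact: law_dist.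
apply: (@le_trans _ _ (P [set w | ~~ bad (g w)])).
  by rewrite h1 lee_fin lerD2l lerN2.
have mSN : measurable ([set w | ~~ bad (g w)] `\` N) by exact: measurableD.
apply: (@le_trans _ _ (P (([set w | ~~ bad (g w)] `\` N) `|` N))).
  apply: le_measure; rewrite ?inE //; first exact: measurableU.
  by move=> w Sw; case: (pselect (N w)) => hw; [right|left].
apply: le_trans (measureU2 _ mSN mN) _.
by rewrite [X in (_ + X)%E](_ : _ = 0%E) ?adde0.
Qed.

End RecoveryEvent.

Theorem theorem1 (R : realType) :
  exists C alpha : R, 0 < C /\ 0 < alpha /\
  forall (n p : nat) (A : 'M[R]_n) (theta : R)
         (d : measure_display) (T : measurableType d) (P : probability T R)
         (chi Rv : 'I_n -> 'I_p -> {RV P >-> R}),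
    (0 < n)%N -> (0 < p)%N ->
    A \in unitmx ->
    BS_model theta chi Rv ->
    2 / n%:R <= theta -> theta <= alpha / Num.sqrt n%:R ->
    C * n%:R * ln (n%:R : R) <= p%:R ->
    exists E : set T, [/\ measurable E,
      E `<=` [set w | erspud_recovers (A *m BS_matrix chi Rv w) (BS_matrix chi Rv w)] &
      ((1 - p%:R^-1)%:E <= P E)%E].
Proof.
have r0 : 0 < rate (@moment_bound R) by exact: rate_gt0 (@moment_bound_ge1 R).
pose D := 6 / rate (@moment_bound R).
have D0 : 0 < D by rewrite divr_gt0.
(* [p >= D n ln p] makes the decay [exp (- rate * p / n)] at most [p^-6], and [1/40] gives
   [n theta^2 <= 1/1600], below the required [1/1280]. *)
exists (256 * D ^+ 4 + 2 * D + 1), (1 / 40).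
have D4 : 0 <= 256 * D ^+ 4 by apply: mulr_ge0; [rewrite ler0n|rewrite exprn_ge0 // ltW].
split; first by lra.
split; first by lra.
move=> n p A theta d T P chi Rv n0 p0 A_unit model th1 th2 hp.
have nR : 0 < n%:R :> R by rewrite ltr0n.
have [/andP[t0 _] _ _ _ _] := model.
have nt : 2 <= n%:R * theta by rewrite mulrC -ler_pdivrMr.
have nt2 : n%:R * theta ^+ 2 <= 1 / 1600.
  have s0 : 0 < Num.sqrt n%:R :> R by rewrite sqrtr_gt0.
  have h : Num.sqrt n%:R * theta <= 1 / 40 by rewrite mulrC -ler_pdivlMr.
  rewrite -[n%:R]sqr_sqrtr ?(ltW nR) // -exprMn.
  have h0 : 0 <= Num.sqrt n%:R * theta by rewrite mulr_ge0 // ltW.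
  by rewrite expr2; have := ler_pM h0 h0 h h; lra.
(* For small [n] the range of [theta] is empty: [4 <= (n theta)^2 <= n / 1600]. *)
have n160 : 160 <= n%:R :> R.
  have : (n%:R * theta) ^+ 2 <= n%:R * (1 / 1600) :> R.
    by rewrite exprMn expr2 -mulrA ler_pM2l.
  by rewrite expr2; have := ler_pM (ler0n R 2) (ler0n R 2) nt nt; lra.
have n4 : (160 <= n)%N by rewrite -(ler_nat R).
have [np hD] := ln_sample_size D0 (leq_trans (isT : (4 <= 160)%N) n4) hp.
have nt2' : n%:R * theta ^+ 2 <= 1 / 1280 by lra.
apply: (exists_recovery_event model n0 (leq_trans n4 np) np nt nt2') => //.
rewrite mulrA ler_pdivlMr // mulrAC.
move: hD; rewrite -(ler_pM2l r0); congr (_ <= _).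
have -> : 6 = rate (@moment_bound R) * D by rewrite mulrC divfK // gt_eqF.
by ring.
Qed.
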